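(* Let $d_{\mathrm{av}}\in\mathbb{R}$, $h\in(0,1]$ and $p>1$. For every initial datum $\varphi_h\in L^2_h(h\mathbb{Z})$ there exists a unique solution $u_h\in \mathcal{C}(\mathbb{R},L^2_h(h\mathbb{Z}))$ of $$ i\partial_t u_h + d_{\mathrm{av}}\,\Delta_h u_h+\int_0^1 T_{h,r}^{-1}\big(|T_{h,r}u_h|^{p-1}T_{h,r}u_h\big)\,dr=0,\qquad u_h(0)=\varphi_h. $$ Moreover, $u_h$ depends continuously on the initial datum (that is, for every $T>0$ the map $\varphi_h\mapsto u_h|_{[-T,T]}$ is continuous from $L^2_h(h\mathbb{Z})$ to $\mathcal{C}([-T,T],L^2_h(h\mathbb{Z}))$), and it conserves the mass and the energy, that is, $$\|u_h(t)\|_{L^2_h}^2=\|\varphi_h\|_{L^2_h}^2\quad\text{and}\quad E(u_h(t))=E(\varphi_h)\qquad\text{for all } t\in\mathbb{R},$$ where for $f\in L^2_h(h\mathbb{Z})$ $$E(f):=\frac{d_{\mathrm{av}}}{2}\|D_h^+f\|_{L^2_h}^2-\frac{1}{p+1}\int_0^1\|T_{h,r}f\|_{L^{p+1}_h}^{p+1}\,dr .$$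
   Context: For $h>0$, $h\mathbb{Z}=\{hm: m\in\mathbb{Z}\}$. For $1\le q<\infty$, $L^q_h(h\mathbb{Z})$ is the Banach space of functions $f:h\mathbb{Z}\to\mathbb{C}$ with finite norm $\|f\|_{L^q_h}=\big(h\sum_{x\in h\mathbb{Z}}|f(x)|^q\big)^{1/q}$. The discrete Laplacian is $(\Delta_h f)(x)=\frac{f(x+h)+f(x-h)-2f(x)}{h^2}$ and the forward difference operator is $(D_h^+f)(x)=\frac{f(x+h)-f(x)}{h}$, $x\in h\mathbb{Z}$. $T_{h,r}=e^{ir\Delta_h}$ is the (unitary on $L^2_h$) solution operator of the discrete Schrödinger equation: $w(\cdot,r)=T_{h,r}\varphi$ solves $i\partial_r w+\Delta_h w=0$, $w(\cdot,0)=\varphi$. A solution of the equation with initial datum $\varphi_h$ is understood as a solution of the integral equation $$u_h(t)=e^{i d_{\mathrm{av}}t\Delta_h}\varphi_h+i\int_0^t e^{i d_{\mathrm{av}}(t-s)\Delta_h}\langle Q_h\rangle(u_h(s))\,ds,\qquad \langle Q_h\rangle(f):=\int_0^1T_{h,r}^{-1}\big(|T_{h,r}f|^{p-1}T_{h,r}f\big)\,dr .$$ *)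

(* Defs.v *)
From Stdlib Require Import Reals Lra Lia ZArith.
From Stdlib Require Import FunctionalExtensionality PropExtensionality ProofIrrelevance ClassicalEpsilon.
From Coquelicot Require Import Coquelicot.

Open Scope R_scope.

(* x^y for x >= 0 and y > 0. Stdlib's [Rpower 0 y] is 1, hence the case
   distinction. *)
Definition Rpow (x y : R) : R :=
  if Req_EM_T x 0 then 0 else Rpower x y.

(* [zpair a] lists (a 0 + a (-1)), (a 1 + a (-2)), ...: every integer is met
   exactly once. It is only used for families a >= 0, for which the order of
   summation is irrelevant. *)
Definition zpair (a : Z -> R) (n : nat) : R :=
  a (Z.of_nat n) + a (- Z.of_nat (S n))%Z.

Definition Zsummable (a : Z -> R) : Prop := ex_series (zpair a).

Definition Zsum (a : Z -> R) : R := Series (zpair a).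

(* A function f on hZ is encoded by m |-> f (h m), of type Z -> C; thus
   x + h and x - h correspond to m + 1 and m - 1. *)

Definition in_Lq (q : R) (f : Z -> C) : Prop :=
  Zsummable (fun m => Rpow (Cmod (f m)) q).

Definition Lq_norm (h q : R) (f : Z -> C) : R :=
  Rpow (h * Zsum (fun m => Rpow (Cmod (f m)) q)) (/ q).

Record L2 (h : posreal) : Type := mkL2 {
  L2_fun :> Z -> C;
  L2_in : in_Lq 2 L2_fun
}.
Arguments mkL2 h {L2_fun} _.

Lemma L2_ext (h : posreal) (f g : L2 h) : (forall m, f m = g m) -> f = g.
Proof.
destruct f as [f Hf], g as [g Hg]; simpl; intros E.
assert (f = g) by (apply functional_extensionality; exact E); subst g.
now rewrite (proof_irrelevance _ Hf Hg).
Qed.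

Lemma Rpow_2 x : 0 <= x -> Rpow x 2 = x * x.
Proof.
intros Hx; unfold Rpow; destruct (Req_EM_T x 0) as [->|H]; [ring|].
replace 2 with (INR 2) by (simpl; lra).
rewrite Rpower_pow by lra; simpl; ring.
Qed.

Lemma Rpow_half x : 0 <= x -> Rpow x (/ 2) = sqrt x.
Proof.
intros Hx; unfold Rpow; destruct (Req_EM_T x 0) as [->|H].
- now rewrite sqrt_0.
- apply Rpower_sqrt; lra.
Qed.

Lemma Rpow_ge0 x y : 0 <= Rpow x y.
Proof.
unfold Rpow; destruct (Req_EM_T x 0); [lra|].
left; apply exp_pos.
Qed.

Lemma Rpow_le x y z : 0 <= x <= y -> 0 <= z -> Rpow x z <= Rpow y z.
Proof.
intros [Hx Hy] Hz; unfold Rpow at 1; destruct (Req_EM_T x 0) as [E|E].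
- apply Rpow_ge0.
- unfold Rpow; destruct (Req_EM_T y 0); [lra|].
  apply Rle_Rpower_l; lra.
Qed.

Definition sqsum (f : Z -> C) (N : nat) : R :=
  sum_n (zpair (fun m => Cmod (f m) * Cmod (f m))) N.

Definition pnorm (h : R) (N : nat) (f : Z -> C) : R := sqrt (h * sqsum f N).

Lemma sqsum_O f : sqsum f 0 = zpair (fun m => Cmod (f m) * Cmod (f m)) 0.
Proof. unfold sqsum; now rewrite sum_O. Qed.

Lemma sqsum_S f N :
  sqsum f (S N) = sqsum f N + zpair (fun m => Cmod (f m) * Cmod (f m)) (S N).
Proof. unfold sqsum; now rewrite sum_Sn. Qed.

Lemma zpair_sq_ge0 (f : Z -> C) n : 0 <= zpair (fun m => Cmod (f m) * Cmod (f m)) n.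
Proof. unfold zpair; nra. Qed.

Lemma sqsum_ge0 f N : 0 <= sqsum f N.
Proof.
induction N as [|N IH]; [rewrite sqsum_O|rewrite sqsum_S];
  generalize (zpair_sq_ge0 f); intros H.
- apply H.
- specialize (H (S N)); lra.
Qed.

Lemma mink_step A s t a x y :
  0 <= A -> 0 <= s -> 0 <= t -> 0 <= a -> 0 <= x -> 0 <= y ->
  sqrt A <= sqrt s + sqrt t -> a <= x + y ->
  sqrt (A + a * a) <= sqrt (s + x * x) + sqrt (t + y * y).
Proof.
intros HA Hs Ht Ha Hx Hy H1 H2.
assert (Hsx : 0 <= s + x * x) by nra.
assert (Hty : 0 <= t + y * y) by nra.
pose proof (sqrt_pos s) as ps; pose proof (sqrt_pos t) as pt.
pose proof (sqrt_pos A) as pA.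
pose proof (sqrt_pos (s + x * x)) as pX; pose proof (sqrt_pos (t + y * y)) as pY.
pose proof (sqrt_sqrt s Hs) as es; pose proof (sqrt_sqrt t Ht) as et.
pose proof (sqrt_sqrt A HA) as eA.
pose proof (sqrt_sqrt _ Hsx) as eX; pose proof (sqrt_sqrt _ Hty) as eY.
set (u := sqrt s) in *; set (v := sqrt t) in *; set (X := sqrt (s + x * x)) in *;
set (Y := sqrt (t + y * y)) in *.
assert (CS : u * v + x * y <= X * Y).
{ apply Rsqr_incr_0_var; [unfold Rsqr|nra].
  replace (X * Y * (X * Y)) with ((X * X) * (Y * Y)) by ring.
  rewrite eX, eY, <- es, <- et.
  pose proof (Rle_0_sqr (u * y - v * x)) as Hq; unfold Rsqr in Hq; nra. }
apply Rsqr_incr_0_var; [unfold Rsqr|lra].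
rewrite sqrt_sqrt by nra.
assert (sqrt A * sqrt A <= (u + v) * (u + v)) by (apply Rmult_le_compat; lra).
assert (a * a <= (x + y) * (x + y)) by (apply Rmult_le_compat; lra).
nra.
Qed.

Lemma sqsum_triangle (f g : Z -> C) N :
  sqrt (sqsum (fun m => (f m + g m)%C) N) <= sqrt (sqsum f N) + sqrt (sqsum g N).
Proof.
assert (P : forall (A s t : R) (n : nat), 0 <= A -> 0 <= s -> 0 <= t ->
  sqrt A <= sqrt s + sqrt t ->
  sqrt (A + zpair (fun m => Cmod (f m + g m)%C * Cmod (f m + g m)%C) n)
  <= sqrt (s + zpair (fun m => Cmod (f m) * Cmod (f m)) n)
     + sqrt (t + zpair (fun m => Cmod (g m) * Cmod (g m)) n)).
{ intros A s t n HA Hs Ht H; unfold zpair; rewrite <- !Rplus_assoc.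
  set (i := Z.of_nat n); set (j := (- Z.of_nat (S n))%Z).
  pose proof (Rle_0_sqr (Cmod (f i + g i)%C)) as q1.
  pose proof (Rle_0_sqr (Cmod (f i))) as q2.
  pose proof (Rle_0_sqr (Cmod (g i))) as q3.
  unfold Rsqr in *.
  apply mink_step; try lra; try apply Cmod_ge_0; try apply Cmod_triangle.
  apply mink_step; try lra; try apply Cmod_ge_0; try apply Cmod_triangle. }
induction N as [|N IH].
- rewrite !sqsum_O.
  specialize (P 0 0 0 0%nat); rewrite sqrt_0, !Rplus_0_l in P; apply P; lra.
- rewrite !sqsum_S; apply P; auto using sqsum_ge0.
Qed.

Lemma pnorm_ge0 h N f : 0 <= pnorm h N f.
Proof. apply sqrt_pos. Qed.

Lemma pnorm_triangle (h : posreal) N (f g : Z -> C) :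
  pnorm h N (fun m => (f m + g m)%C) <= pnorm h N f + pnorm h N g.
Proof.
pose proof (cond_pos h) as Hh.
unfold pnorm; rewrite !sqrt_mult by (try apply sqsum_ge0; lra).
rewrite <- Rmult_plus_distr_l; apply Rmult_le_compat_l; [apply sqrt_pos|].
apply sqsum_triangle.
Qed.

Lemma sqsum_le (c : R) (f g : Z -> C) N : 0 <= c ->
  (forall m, Cmod (g m) <= c * Cmod (f m)) -> sqsum g N <= c * c * sqsum f N.
Proof.
intros Hc H.
assert (K : forall m, Cmod (g m) * Cmod (g m) <= c * c * (Cmod (f m) * Cmod (f m))).
{ intros m; replace (c * c * (Cmod (f m) * Cmod (f m)))
    with ((c * Cmod (f m)) * (c * Cmod (f m))) by ring.
  apply Rmult_le_compat; auto using Cmod_ge_0. }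
induction N as [|N IH]; rewrite ?sqsum_O, ?sqsum_S; unfold zpair.
- generalize (K (Z.of_nat 0)) (K (- Z.of_nat 1)%Z); lra.
- generalize (K (Z.of_nat (S N))) (K (- Z.of_nat (S (S N)))%Z); lra.
Qed.

Lemma pnorm_le (h : posreal) (c : R) (f g : Z -> C) N : 0 <= c ->
  (forall m, Cmod (g m) <= c * Cmod (f m)) -> pnorm h N g <= c * pnorm h N f.
Proof.
intros Hc H; pose proof (cond_pos h) as Hh.
unfold pnorm.
rewrite <- (sqrt_square c Hc) at 1.
rewrite <- sqrt_mult by (try apply Rmult_le_pos; try apply sqsum_ge0; lra || nra).
apply sqrt_le_1_alt.
replace (c * c * (h * sqsum f N)) with (h * (c * c * sqsum f N)) by ring.
apply Rmult_le_compat_l; [lra|now apply sqsum_le].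
Qed.

Lemma pnorm_ext h N (f g : Z -> C) : (forall m, f m = g m) -> pnorm h N f = pnorm h N g.
Proof. intros E; f_equal; now apply functional_extensionality. Qed.

Lemma in_Lq2_eq f : in_Lq 2 f <-> ex_series (zpair (fun m => Cmod (f m) * Cmod (f m))).
Proof.
unfold in_Lq, Zsummable.
replace (fun m => Rpow (Cmod (f m)) 2) with (fun m => Cmod (f m) * Cmod (f m)).
- tauto.
- apply functional_extensionality; intros m; now rewrite Rpow_2 by apply Cmod_ge_0.
Qed.

Lemma Lq_norm2_eq h f :
  0 <= h -> in_Lq 2 f ->
  Lq_norm h 2 f = sqrt (h * Series (zpair (fun m => Cmod (f m) * Cmod (f m)))).
Proof.
intros Hh Hf; unfold Lq_norm, Zsum.
replace (fun m => Rpow (Cmod (f m)) 2) with (fun m => Cmod (f m) * Cmod (f m)).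
2: { apply functional_extensionality; intros m; now rewrite Rpow_2 by apply Cmod_ge_0. }
apply Rpow_half, Rmult_le_pos; auto.
replace 0 with (Series (fun _ : nat => 0)).
- apply Series_le; [|now apply in_Lq2_eq].
  intros n; split; [lra|apply zpair_sq_ge0].
- unfold Series; rewrite (Lim_seq_ext _ (fun _ => 0)).
  + now rewrite Lim_seq_const.
  + intros n; rewrite sum_n_const; ring.
Qed.

Lemma sqsum_incr f N : sqsum f N <= sqsum f (S N).
Proof. rewrite sqsum_S; generalize (zpair_sq_ge0 f (S N)); lra. Qed.

Lemma pnorm_bound_in (h : posreal) (e : R) (f : Z -> C) :
  (forall N, pnorm h N f <= e) -> in_Lq 2 f.
Proof.
intros H; apply in_Lq2_eq; pose proof (cond_pos h) as Hh.
destruct (ex_finite_lim_seq_incr (sqsum f) (e * e / h)) as [l Hl].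
- apply sqsum_incr.
- intros N; specialize (H N).
  assert (0 <= h * sqsum f N) as Hp by (apply Rmult_le_pos; [lra|apply sqsum_ge0]).
  assert (h * sqsum f N <= e * e).
  { rewrite <- (sqrt_sqrt _ Hp); apply Rmult_le_compat; auto using sqrt_pos. }
  apply Rmult_le_reg_l with h; auto; field_simplify; lra.
- exists l; exact Hl.
Qed.

Lemma pnorm_le_norm (h : posreal) (f : Z -> C) N :
  in_Lq 2 f -> pnorm h N f <= Lq_norm h 2 f.
Proof.
intros Hf; pose proof (cond_pos h) as Hh.
rewrite Lq_norm2_eq by (auto; lra).
apply sqrt_le_1_alt, Rmult_le_compat_l; [lra|].
apply in_Lq2_eq in Hf; apply Series_correct in Hf.
apply (is_lim_seq_incr_compare (sqsum f)); auto using sqsum_incr.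
Qed.

Lemma norm_le_pnorm (h : posreal) (f : Z -> C) (e : R) :
  in_Lq 2 f -> (forall N, pnorm h N f <= e) -> Lq_norm h 2 f <= e.
Proof.
intros Hf H; pose proof (cond_pos h) as Hh.
assert (He : 0 <= e) by (apply Rle_trans with (2 := H 0%nat), pnorm_ge0).
rewrite Lq_norm2_eq by (auto; lra).
rewrite <- (sqrt_square e He); apply sqrt_le_1_alt.
apply in_Lq2_eq in Hf; apply Series_correct in Hf.
apply (fun K => is_lim_seq_scal_l (sqsum f) h (Finite _) K) in Hf.
change (Rbar_le (h * Series (zpair (fun m => Cmod (f m) * Cmod (f m)))) (e * e)).
apply (is_lim_seq_le (fun N => h * sqsum f N) (fun _ => e * e)).
- intros N.
  assert (0 <= h * sqsum f N) as Hp by (apply Rmult_le_pos; [lra|apply sqsum_ge0]).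
  rewrite <- (sqrt_sqrt _ Hp); apply Rmult_le_compat; auto using sqrt_pos; apply H.
- exact Hf.
- apply is_lim_seq_const.
Qed.

Lemma coord_sqsum f n : Cmod (f (Z.of_nat n)) * Cmod (f (Z.of_nat n)) <= sqsum f n
  /\ Cmod (f (- Z.of_nat (S n))%Z) * Cmod (f (- Z.of_nat (S n))%Z) <= sqsum f n.
Proof.
pose proof (Rle_0_sqr (Cmod (f (Z.of_nat n)))) as Q1.
pose proof (Rle_0_sqr (Cmod (f (- Z.of_nat (S n))%Z))) as Q2.
unfold Rsqr in *.
destruct n; [rewrite sqsum_O|rewrite sqsum_S; generalize (sqsum_ge0 f n)];
  unfold zpair; lra.
Qed.

Lemma coord_pnorm (h : posreal) (m : Z) :
  exists N, forall f, sqrt h * Cmod (f m) <= pnorm h N f.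
Proof.
pose proof (cond_pos h) as Hh.
assert (exists N, forall f, Cmod (f m) * Cmod (f m) <= sqsum f N) as [N HN].
{ destruct (Z_le_gt_dec 0 m).
  - exists (Z.to_nat m); intros f.
    pose proof (proj1 (coord_sqsum f (Z.to_nat m))) as K.
    now rewrite Z2Nat.id in K.
  - exists (pred (Z.to_nat (- m))); intros f.
    pose proof (proj2 (coord_sqsum f (pred (Z.to_nat (- m))))) as K.
    now replace (- Z.of_nat (S (Init.Nat.pred (Z.to_nat (- m)))))%Z with m in K by lia. }
exists N; intros f; unfold pnorm.
rewrite sqrt_mult by (try apply sqsum_ge0; lra).
apply Rmult_le_compat_l; [apply sqrt_pos|].
rewrite <- (sqrt_square (Cmod (f m))) by apply Cmod_ge_0.
now apply sqrt_le_1_alt.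
Qed.

Definition one_pos : posreal := mkposreal 1 Rlt_0_1.

Lemma in_L2_plus f g : in_Lq 2 f -> in_Lq 2 g -> in_Lq 2 (fun m => (f m + g m)%C).
Proof.
intros Hf Hg; apply (pnorm_bound_in one_pos (Lq_norm one_pos 2 f + Lq_norm one_pos 2 g)).
intros N; eapply Rle_trans; [apply pnorm_triangle|].
apply Rplus_le_compat; now apply pnorm_le_norm.
Qed.

Lemma in_L2_le (c : R) (f g : Z -> C) : 0 <= c ->
  (forall m, Cmod (g m) <= c * Cmod (f m)) -> in_Lq 2 f -> in_Lq 2 g.
Proof.
intros Hc H Hf; apply (pnorm_bound_in one_pos (c * Lq_norm one_pos 2 f)).
intros N; eapply Rle_trans; [now apply (pnorm_le _ c f g)|].
apply Rmult_le_compat_l; auto; now apply pnorm_le_norm.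
Qed.

Lemma in_L2_scal (c : C) f : in_Lq 2 f -> in_Lq 2 (fun m => (c * f m)%C).
Proof.
apply (in_L2_le (Cmod c)); [apply Cmod_ge_0|].
intros m; rewrite Cmod_mult; lra.
Qed.

Lemma in_L2_zero : in_Lq 2 (fun _ => 0%C).
Proof.
apply (pnorm_bound_in one_pos 0); intros N.
apply Rle_trans with (0 * pnorm one_pos N (fun _ => 0%C)); [|lra].
apply pnorm_le; [lra|]; intros m; rewrite Cmod_0; lra.
Qed.

Lemma in_L2_shift_r f : in_Lq 2 f -> in_Lq 2 (fun m => f (m + 1)%Z).
Proof.
intros Hf; apply (pnorm_bound_in one_pos (Lq_norm one_pos 2 f)); intros N.
eapply Rle_trans; [|now apply (pnorm_le_norm _ _ (S N))].
apply sqrt_le_1_alt; simpl; rewrite !Rmult_1_l.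
set (a := fun m => Cmod (f m) * Cmod (f m)).
assert (K : sqsum (fun m => f (m + 1)%Z) N
            = sqsum f N + a (Z.of_nat (S N)) - a (- Z.of_nat (S N))%Z).
{ induction N as [|N IH]; [rewrite !sqsum_O|rewrite !sqsum_S, IH]; unfold zpair, a.
  - simpl; ring.
  - replace (Z.of_nat (S N) + 1)%Z with (Z.of_nat (S (S N))) by lia.
    replace (- Z.of_nat (S (S N)) + 1)%Z with (- Z.of_nat (S N))%Z by lia.
    ring. }
rewrite K, sqsum_S; unfold zpair; fold (a (Z.of_nat (S N))).
assert (P : forall m, 0 <= a m) by (intros m; apply Rle_0_sqr).
pose proof (P (- Z.of_nat (S N))%Z); pose proof (P (- Z.of_nat (S (S N)))%Z).
unfold a in *; lra.
Qed.

Lemma in_L2_shift_l f : in_Lq 2 f -> in_Lq 2 (fun m => f (m - 1)%Z).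
Proof.
intros Hf; apply (pnorm_bound_in one_pos (Lq_norm one_pos 2 f)); intros N.
eapply Rle_trans; [|now apply (pnorm_le_norm _ _ (S N))].
apply sqrt_le_1_alt; simpl; rewrite !Rmult_1_l.
set (a := fun m => Cmod (f m) * Cmod (f m)).
assert (K : sqsum (fun m => f (m - 1)%Z) N
            = sqsum f N - a (Z.of_nat N) + a (- Z.of_nat (S (S N)))%Z).
{ induction N as [|N IH]; [rewrite !sqsum_O|rewrite !sqsum_S, IH]; unfold zpair, a.
  - simpl; ring.
  - replace (Z.of_nat (S N) - 1)%Z with (Z.of_nat N) by lia.
    replace (- Z.of_nat (S (S N)) - 1)%Z with (- Z.of_nat (S (S (S N))))%Z by lia.
    ring. }
rewrite K, sqsum_S; unfold zpair.
assert (P : forall m, 0 <= a m) by (intros m; apply Rle_0_sqr).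
pose proof (P (Z.of_nat N)); pose proof (P (Z.of_nat (S N))).
unfold a in *; lra.
Qed.

Section L2Space.
Variable h : posreal.

Definition L2_zero : L2 h := mkL2 h in_L2_zero.
Definition L2_plus (f g : L2 h) : L2 h := mkL2 h (in_L2_plus f g (L2_in _ f) (L2_in _ g)).
Definition L2_cscal (c : C) (f : L2 h) : L2 h := mkL2 h (in_L2_scal c f (L2_in _ f)).
Definition L2_opp (f : L2 h) : L2 h := L2_cscal (- (1))%C f.
Definition L2_scal (a : R) (f : L2 h) : L2 h := L2_cscal (RtoC a) f.

Lemma L2_plus_comm f g : L2_plus f g = L2_plus g f.
Proof. apply L2_ext; intros m; simpl; ring. Qed.

Lemma L2_plus_assoc f g k : L2_plus f (L2_plus g k) = L2_plus (L2_plus f g) k.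
Proof. apply L2_ext; intros m; simpl; ring. Qed.

Lemma L2_plus_zero f : L2_plus f L2_zero = f.
Proof. apply L2_ext; intros m; simpl; ring. Qed.

Lemma L2_plus_opp f : L2_plus f (L2_opp f) = L2_zero.
Proof. apply L2_ext; intros m; simpl; ring. Qed.

Definition L2_AbelianMonoid_mixin :=
  AbelianMonoid.Mixin (L2 h) L2_plus L2_zero L2_plus_comm L2_plus_assoc L2_plus_zero.
Canonical L2_AbelianMonoid := AbelianMonoid.Pack _ L2_AbelianMonoid_mixin (L2 h).

Definition L2_AbelianGroup_mixin := AbelianGroup.Mixin L2_AbelianMonoid L2_opp L2_plus_opp.
Canonical L2_AbelianGroup := AbelianGroup.Pack _
  (AbelianGroup.Class _ L2_AbelianMonoid_mixin L2_AbelianGroup_mixin) (L2 h).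

Lemma L2_scal_assoc (a b : R) f : L2_scal a (L2_scal b f) = L2_scal (a * b) f.
Proof. apply L2_ext; intros m; simpl; rewrite RtoC_mult; ring. Qed.

Lemma L2_scal_one f : L2_scal 1 f = f.
Proof. apply L2_ext; intros m; simpl; ring. Qed.

Lemma L2_scal_plus (a : R) f g :
  L2_scal a (L2_plus f g) = L2_plus (L2_scal a f) (L2_scal a g).
Proof. apply L2_ext; intros m; simpl; ring. Qed.

Lemma L2_plus_scal (a b : R) f :
  L2_scal (a + b) f = L2_plus (L2_scal a f) (L2_scal b f).
Proof. apply L2_ext; intros m; simpl; rewrite RtoC_plus; ring. Qed.

Definition L2_ModuleSpace_mixin := ModuleSpace.Mixin R_Ring L2_AbelianGroup
  L2_scal L2_scal_assoc L2_scal_one L2_scal_plus L2_plus_scal.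
Canonical L2_ModuleSpace := ModuleSpace.Pack R_Ring (L2 h)
  (ModuleSpace.Class R_Ring (L2 h) (AbelianGroup.class L2_AbelianGroup) L2_ModuleSpace_mixin)
  (L2 h).

Definition L2_norm (f : L2 h) : R := Lq_norm h 2 f.

Lemma L2_norm_le (f : L2 h) e : (forall N, pnorm h N f <= e) -> L2_norm f <= e.
Proof. apply norm_le_pnorm, L2_in. Qed.

Lemma L2_pnorm_le (f : L2 h) N : pnorm h N f <= L2_norm f.
Proof. apply pnorm_le_norm, L2_in. Qed.

Lemma L2_norm_triangle f g : L2_norm (L2_plus f g) <= L2_norm f + L2_norm g.
Proof.
apply L2_norm_le; intros N; eapply Rle_trans; [apply pnorm_triangle|].
apply Rplus_le_compat; apply L2_pnorm_le.
Qed.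

Lemma L2_norm_cscal (c : C) f : L2_norm (L2_cscal c f) <= Cmod c * L2_norm f.
Proof.
apply L2_norm_le; intros N; eapply Rle_trans.
- apply (pnorm_le h (Cmod c) f); [apply Cmod_ge_0|].
  intros m; simpl; rewrite Cmod_mult; lra.
- apply Rmult_le_compat_l; [apply Cmod_ge_0|apply L2_pnorm_le].
Qed.

Lemma L2_norm_scal (a : R) f : L2_norm (L2_scal a f) <= Rabs a * L2_norm f.
Proof. unfold L2_scal; rewrite <- Cmod_R; apply L2_norm_cscal. Qed.

Lemma L2_norm_coord (f : L2 h) m : Cmod (f m) <= L2_norm f / sqrt h.
Proof.
assert (0 < sqrt h) by (apply sqrt_lt_R0, cond_pos).
destruct (coord_pnorm h m) as [N HN].
apply Rmult_le_reg_l with (sqrt h); auto.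
field_simplify; [|lra].
eapply Rle_trans; [apply HN|apply (L2_pnorm_le _ N)].
Qed.

Lemma L2_norm_eq0 f : L2_norm f = 0 -> f = L2_zero.
Proof.
intros H; apply L2_ext; intros m; apply Cmod_eq_0.
pose proof (L2_norm_coord f m) as K; rewrite H in K; unfold Rdiv in K.
pose proof (Cmod_ge_0 (f m)); lra.
Qed.

Definition L2_dist (f g : L2 h) : R := L2_norm (L2_plus g (L2_opp f)).

Definition L2_ball (f : L2 h) (e : R) (g : L2 h) : Prop := L2_dist f g < e.

Lemma L2_norm_zero : L2_norm L2_zero = 0.
Proof.
apply Rle_antisym; [|apply Rpow_ge0].
replace L2_zero with (L2_scal 0 L2_zero).
- eapply Rle_trans; [apply L2_norm_scal|rewrite Rabs_R0; lra].
- apply L2_ext; intros m; simpl; ring.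
Qed.

Lemma L2_norm_opp f : L2_norm (L2_opp f) <= L2_norm f.
Proof.
eapply Rle_trans; [apply L2_norm_cscal|].
rewrite Cmod_opp, Cmod_1; lra.
Qed.

Lemma L2_ball_center (f : L2 h) (e : posreal) : L2_ball f e f.
Proof.
unfold L2_ball, L2_dist; rewrite L2_plus_opp, L2_norm_zero; apply cond_pos.
Qed.

Lemma L2_ball_sym (f g : L2 h) (e : R) : L2_ball f e g -> L2_ball g e f.
Proof.
intros H; apply Rle_lt_trans with (2 := H); unfold L2_dist.
replace (L2_plus f (L2_opp g)) with (L2_opp (L2_plus g (L2_opp f))).
- apply L2_norm_opp.
- apply L2_ext; intros m; simpl; ring.
Qed.

Lemma L2_ball_triangle (f g k : L2 h) (e1 e2 : R) :
  L2_ball f e1 g -> L2_ball g e2 k -> L2_ball f (e1 + e2) k.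
Proof.
unfold L2_ball, L2_dist; intros H1 H2.
replace (L2_plus k (L2_opp f))
  with (L2_plus (L2_plus g (L2_opp f)) (L2_plus k (L2_opp g))).
- eapply Rle_lt_trans; [apply L2_norm_triangle|lra].
- apply L2_ext; intros m; simpl; ring.
Qed.

Definition L2_UniformSpace_mixin := UniformSpace.Mixin (L2 h) L2_zero
  L2_ball L2_ball_center L2_ball_sym L2_ball_triangle.
Canonical L2_UniformSpace := UniformSpace.Pack (L2 h) L2_UniformSpace_mixin (L2 h).

Canonical L2_NormedModuleAux := NormedModuleAux.Pack R_AbsRing (L2 h)
  (NormedModuleAux.Class R_AbsRing (L2 h) (ModuleSpace.class R_Ring L2_ModuleSpace)
     L2_UniformSpace_mixin) (L2 h).

Lemma L2_norm_ball1 (f g : L2 h) (e : R) : L2_norm (minus g f) < e -> ball f e g.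
Proof. exact (fun H => H). Qed.

Lemma L2_norm_ball2 (f g : L2 h) (e : posreal) : ball f e g -> L2_norm (minus g f) < 1 * e.
Proof. rewrite Rmult_1_l; exact (fun H => H). Qed.

Definition L2_NormedModule_mixin := NormedModule.Mixin R_AbsRing L2_NormedModuleAux
  L2_norm 1 L2_norm_triangle L2_norm_scal L2_norm_ball1 L2_norm_ball2 L2_norm_eq0.
Canonical L2_NormedModule := NormedModule.Pack R_AbsRing (L2 h)
  (NormedModule.Class R_AbsRing (L2 h) (NormedModuleAux.class R_AbsRing L2_NormedModuleAux)
     L2_NormedModule_mixin) (L2 h).

Lemma L2_complete (F : (L2 h -> Prop) -> Prop) :
  ProperFilter F -> cauchy F -> exists l : L2 h, forall e : posreal, F (ball l e).
Proof.
intros FF CF.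
assert (Hs : 0 < sqrt h) by (apply sqrt_lt_R0, cond_pos).
assert (Cau : forall e : posreal, exists g : L2 h, F (fun k => L2_dist g k < e))
  by exact CF.
assert (PW : forall m, exists z : C, forall e : posreal, F (fun k => Cmod (k m - z)%C < e)).
{ intros m.
  set (Fm := filtermap (fun k : L2 h => k m) F).
  assert (PFm : ProperFilter Fm) by (apply filtermap_proper_filter; exact FF).
  assert (CFm : cauchy (T := C_UniformSpace) Fm).
  { intros e.
    assert (He : 0 < e * sqrt h) by (apply Rmult_lt_0_compat; [apply cond_pos|auto]).
    destruct (Cau (mkposreal _ He)) as [g Hg]; exists (g m).
    unfold Fm, filtermap; eapply filter_imp; [|exact Hg]; simpl; intros k Hk.
    apply (norm_compat1 (V := C_NormedModule)).
    change (Cmod (k m - g m)%C < e).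
    pose proof (L2_norm_coord (L2_plus k (L2_opp g)) m) as K; simpl in K.
    replace (k m - g m)%C with (k m + - (1) * g m)%C by ring.
    eapply Rle_lt_trans; [apply K|].
    apply Rmult_lt_reg_r with (sqrt h); auto.
    unfold Rdiv; rewrite Rmult_assoc, Rinv_l by lra; rewrite Rmult_1_r; exact Hk. }
  exists (Hierarchy.lim (T := C_CompleteNormedModule) Fm); intros e.
  assert (He : 0 < e / (2 * @norm_factor _ C_NormedModule)).
  { apply Rdiv_lt_0_compat; [apply cond_pos|].
    apply Rmult_lt_0_compat; [lra|apply norm_factor_gt_0]. }
  pose proof (complete_cauchy (T := C_CompleteNormedModule) Fm PFm CFm (mkposreal _ He)) as K.
  unfold Fm, filtermap in K; eapply filter_imp; [|exact K]; intros k Hk.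
  apply (norm_compat2 (V := C_NormedModule)) in Hk.
  change (Cmod (k m - Hierarchy.lim (T := C_CompleteNormedModule) Fm)%C
    < @norm_factor _ C_NormedModule * (e / (2 * @norm_factor _ C_NormedModule))) in Hk.
  pose proof (@norm_factor_gt_0 _ C_NormedModule) as Hn.
  replace (@norm_factor _ C_NormedModule * (e / (2 * @norm_factor _ C_NormedModule)))
    with (e / 2) in Hk by (field; lra).
  pose proof (cond_pos e); eapply Rlt_trans; [exact Hk|lra]. }
destruct (choice _ PW) as [l Hl]; clear PW.
assert (Coord : forall N (d : posreal),
   F (fun k => pnorm h N (fun m => (l m - k m)%C) < d)).
{ assert (A : forall N (d : posreal),
     F (fun k => sqsum (fun m => (l m - k m)%C) N < d)).
  { assert (P1 : forall m (d : posreal), F (fun k =>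
      Cmod (l m - k m)%C * Cmod (l m - k m)%C < d)).
    { intros m d.
      assert (Hd : 0 < sqrt d) by (apply sqrt_lt_R0, cond_pos).
      eapply filter_imp; [|apply (Hl m (mkposreal _ Hd))]; simpl; intros k Hk.
      rewrite <- (sqrt_sqrt d) by (left; apply cond_pos).
      replace (l m - k m)%C with (- (k m - l m))%C by ring; rewrite Cmod_opp.
      apply Rmult_le_0_lt_compat; auto using Cmod_ge_0. }
    assert (P2 : forall n (d : posreal), F (fun k =>
      zpair (fun m => Cmod (l m - k m)%C * Cmod (l m - k m)%C) n < d)).
    { intros n d; unfold zpair.
      eapply filter_imp; [|apply filter_and;
        [apply (P1 (Z.of_nat n) (pos_div_2 d))|
         apply (P1 (- Z.of_nat (S n))%Z (pos_div_2 d))]].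
      intros k [H1 H2]; rewrite <- (Rplus_half_diag d).
      now apply Rplus_lt_compat. }
    induction N as [|N IH]; intros d.
    - eapply filter_imp; [|apply (P2 0%nat d)]; intros k Hk; now rewrite sqsum_O.
    - eapply filter_imp; [|apply filter_and;
        [apply (IH (pos_div_2 d))|apply (P2 (S N) (pos_div_2 d))]].
      intros k [H1 H2]; rewrite sqsum_S, <- (Rplus_half_diag d).
      now apply Rplus_lt_compat. }
  intros N d.
  assert (Hd : 0 < d * d / h).
  { apply Rdiv_lt_0_compat; [apply Rmult_lt_0_compat|]; apply cond_pos. }
  eapply filter_imp; [|apply (A N (mkposreal _ Hd))]; simpl; intros k Hk.
  pose proof (cond_pos d) as Pd; pose proof (cond_pos h) as Ph.
  rewrite <- (sqrt_square d) by lra; apply sqrt_lt_1_alt; split.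
  - apply Rmult_le_pos; [lra|apply sqsum_ge0].
  - apply Rmult_lt_reg_r with (/ h); [now apply Rinv_0_lt_compat|].
    replace (h * sqsum (fun m => (l m - k m)%C) N * / h)
      with (sqsum (fun m => (l m - k m)%C) N) by (field; lra).
    exact Hk. }
assert (Near : forall (g : L2 h) (e : R), F (fun k => L2_dist g k < e) ->
   forall N, pnorm h N (fun m => (l m - g m)%C) <= e).
{ intros g e Hg N; apply le_epsilon; intros d Hd; rewrite (Rplus_comm e d).
  destruct (filter_ex _ (filter_and _ _ Hg (Coord N (mkposreal d Hd)))) as [k [H1 H2]].
  simpl pos in H2.
  rewrite (pnorm_ext h N (fun m => (l m - g m)%C)
    (fun m => ((l m - k m) + (L2_plus k (L2_opp g)) m)%C))
    by (intros m; simpl; ring).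
  eapply Rle_trans; [apply pnorm_triangle|].
  pose proof (L2_pnorm_le (L2_plus k (L2_opp g)) N) as H3.
  unfold L2_dist in H1; apply Rplus_le_compat; [left; exact H2|].
  eapply Rle_trans; [exact H3|left; exact H1]. }
assert (Lin : in_Lq 2 l).
{ destruct (Cau one_pos) as [g Hg].
  replace l with (fun m => ((l m - g m) + g m)%C)
    by (apply functional_extensionality; intros m; ring).
  apply in_L2_plus; [|apply L2_in].
  apply (pnorm_bound_in h 1); intros N; now apply (Near g). }
exists (mkL2 h Lin); intros e.
destruct (Cau (pos_div_2 e)) as [g Hg].
eapply filter_imp; [|exact Hg]; simpl pos; intros k Hk.
replace (pos e) with (e / 2 + e / 2) by field.
change (L2_ball (mkL2 h Lin) (e / 2 + e / 2) k).
unfold L2_ball, L2_dist.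
replace (L2_plus k (L2_opp (mkL2 h Lin)))
  with (L2_plus (L2_opp (L2_plus (mkL2 h Lin) (L2_opp g))) (L2_plus k (L2_opp g)))
  by (apply L2_ext; intros m; simpl; ring).
eapply Rle_lt_trans; [apply L2_norm_triangle|].
apply Rplus_le_lt_compat; [|exact Hk].
eapply Rle_trans; [apply L2_norm_opp|].
apply L2_norm_le; intros N.
rewrite (pnorm_ext h N _ (fun m => (l m - g m)%C)) by (intros m; simpl; ring).
now apply Near.
Qed.

Definition L2_lim (F : (L2 h -> Prop) -> Prop) : L2 h :=
  epsilon (inhabits L2_zero) (fun l : L2 h => forall e : posreal, F (ball l e)).

Lemma L2_lim_cauchy (F : (L2 h -> Prop) -> Prop) :
  ProperFilter F -> cauchy F -> forall e : posreal, F (ball (L2_lim F) e).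
Proof.
intros PF CF; unfold L2_lim; apply epsilon_spec; now apply L2_complete.
Qed.

Lemma L2_lim_close (F1 F2 : (L2 h -> Prop) -> Prop) :
  filter_le F1 F2 -> filter_le F2 F1 -> close (L2_lim F1) (L2_lim F2).
Proof.
intros H1 H2.
replace F2 with F1; [intros e; apply ball_center|].
apply functional_extensionality; intros P; apply propositional_extensionality.
split; [apply H2|apply H1].
Qed.

Definition L2_CompleteSpace_mixin :=
  CompleteSpace.Mixin L2_UniformSpace L2_lim L2_lim_cauchy L2_lim_close.
Canonical L2_CompleteSpace := CompleteSpace.Pack (L2 h)
  (CompleteSpace.Class (L2 h) L2_UniformSpace_mixin L2_CompleteSpace_mixin) (L2 h).
Canonical L2_CompleteNormedModule := CompleteNormedModule.Pack R_AbsRing (L2 h)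
  (CompleteNormedModule.Class R_AbsRing (L2 h)
     (NormedModule.class R_AbsRing L2_NormedModule) L2_CompleteSpace_mixin) (L2 h).

End L2Space.

Arguments L2_cscal {h} c f.

Definition lap_fun (h : R) (f : Z -> C) (m : Z) : C :=
  ((f (m + 1)%Z + f (m - 1)%Z - 2 * f m) / (h ^ 2)%R)%C.

Definition fwd_fun (h : R) (f : Z -> C) (m : Z) : C :=
  ((f (m + 1)%Z - f m) / h)%C.

Lemma lap_in_L2 (h : R) f : in_Lq 2 f -> in_Lq 2 (lap_fun h f).
Proof.
intros Hf.
replace (lap_fun h f) with
  (fun m => (/ (h ^ 2)%R * ((f (m + 1)%Z + f (m - 1)%Z) + (- (2)) * f m))%C).
- apply in_L2_scal, in_L2_plus; [|now apply in_L2_scal].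
  apply (in_L2_plus (fun m => f (m + 1)%Z) (fun m => f (m - 1)%Z)).
  + now apply in_L2_shift_r.
  + now apply in_L2_shift_l.
- apply functional_extensionality; intros m; unfold lap_fun, Cdiv; ring.
Qed.

Lemma fwd_in_L2 (h : R) f : in_Lq 2 f -> in_Lq 2 (fwd_fun h f).
Proof.
intros Hf.
replace (fwd_fun h f) with (fun m => (/ h * (f (m + 1)%Z + (- (1)) * f m))%C).
- apply in_L2_scal.
  apply (in_L2_plus (fun m => f (m + 1)%Z)); [|now apply in_L2_scal].
  now apply in_L2_shift_r.
- apply functional_extensionality; intros m; unfold fwd_fun, Cdiv; ring.
Qed.

Definition Lap {h : posreal} (f : L2 h) : L2 h :=
  mkL2 h (lap_in_L2 h f (L2_in _ f)).

Definition Dplus {h : posreal} (f : L2 h) : L2 h :=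
  mkL2 h (fwd_in_L2 h f (L2_in _ f)).

Definition vseries {V : CompleteNormedModule R_AbsRing} (a : nat -> V) : V :=
  Hierarchy.lim (filtermap (sum_n a) eventually).

(* exp(A) f = sum_k A^k f / k!, the series converging in the norm of V when A
   is a bounded linear operator. *)
Definition op_exp {V : CompleteNormedModule R_AbsRing} (A : V -> V) (f : V) : V :=
  vseries (fun k => scal (/ INR (fact k)) (Nat.iter k A f)).

(* T_{h,r} = exp(i r Lap). *)
Definition Th {h : posreal} (r : R) : L2 h -> L2 h :=
  op_exp (fun g => L2_cscal (Ci * r)%C (Lap g)).

(* The inverse of the bijection [Th r]: [iota] selects the unique g. *)
Definition Th_inv {h : posreal} (r : R) (f : L2 h) : L2 h :=
  iota (fun g : L2 h => Th r g = f).

Definition pow_fun (p : R) (f : Z -> C) (m : Z) : C :=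
  (Rpow (Cmod (f m)) (p - 1) * f m)%C.

Lemma pow_in_L2 (h : posreal) (p : R) (hp : 1 < p) (f : L2 h) : in_Lq 2 (pow_fun p f).
Proof.
apply (in_L2_le (Rpow (L2_norm h f / sqrt h) (p - 1)) f);
  [apply Rpow_ge0| |apply L2_in].
intros m; unfold pow_fun; rewrite Cmod_mult, Cmod_R, Rabs_pos_eq by apply Rpow_ge0.
apply Rmult_le_compat_r; [apply Cmod_ge_0|].
apply Rpow_le; [split; [apply Cmod_ge_0|apply L2_norm_coord]|lra].
Qed.

Definition pow_nl {h : posreal} {p : R} (hp : 1 < p) (f : L2 h) : L2 h :=
  mkL2 h (pow_in_L2 h p hp f).

Definition Qav {h : posreal} {p : R} (hp : 1 < p) (f : L2 h) : L2 h :=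
  RInt (fun r => Th_inv r (pow_nl hp (Th r f))) 0 1.

(* The integral equation; exp(i dav t Lap) is [Th (dav * t)]. *)
Definition is_solution {h : posreal} {p : R} (hp : 1 < p) (dav : R)
    (phi : L2 h) (u : R -> L2 h) : Prop :=
  (forall t, continuous u t) /\
  (forall t, u t = plus (Th (dav * t) phi)
     (L2_cscal Ci (RInt (fun s => Th (dav * (t - s)) (Qav hp (u s))) 0 t))).

Definition energy {h : posreal} (p dav : R) (f : L2 h) : R :=
  dav / 2 * norm (Dplus f) ^ 2
  - 1 / (p + 1) * RInt (fun r => Rpow (Lq_norm h (p + 1) (Th r f)) (p + 1)) 0 1.

(* Main.v *)
(** The discrete Laplacian is bounded on L^2_h and L^2_h embeds into l^oo, so the
    equation is the ODE u' = G u with a field G that is Lipschitz on balls.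
    Since Lap is symmetric, T_{h,r} is unitary, and |z|^(p-1) z is a real multiple
    of z, the field satisfies Re <f, G f> = 0.  Composing G with the radial
    projection onto a ball keeps this orthogonality and makes the field globally
    Lipschitz; the Picard solution of the truncated equation then conserves the
    norm, hence never leaves the ball and solves the original equation for all
    times.  Uniqueness and continuous dependence are Gronwall's inequality on that
    ball.  The energy has the L^2 gradient -X with X = dav Lap f + <Q_h>(f), up to
    an error quadratic in the increment, and G = i X, so the energy is constant.
    Duhamel's formula and the ODE are equivalent because
    v(t) = exp(-i dav t Lap) u(t) satisfies v' = i exp(-i dav t Lap) <Q_h>(u). *)

Require Import Defs.
From Stdlib Require Import Reals Lra Lia ZArith FunctionalExtensionality ClassicalEpsilon.
From Coquelicot Require Import Coquelicot.
Open Scope R_scope.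

(** * Calculus with values in normed modules *)

(** For 1 < p < 2 the factor |z|^(p-1) is not Lipschitz at 0, so the power is never differentiated
    there: mean values are taken at positive arguments only and the value 0 is treated apart. No
    differentiability of the field is used either. The functionals are differentiated along curves
    through a quadratic bound on their first-order remainder. Such a bound survives summation over
    the lattice and integration over r, so no derivative is interchanged with a sum or an integral.
    Its constant depends only on a radius, and T_{h,r} preserves radii, which makes it uniform in r.

    The constants come from two facts: Lap has norm at most 4 / h^2, and sup |f| is at most the norm
    of f divided by sqrt h.

    Only the real part of the inner product is kept. It is the scalar product of L^2_h as a real
    space, in which i is just a skew operator, and mass, gradient and orthogonality are all
    statements about it. *)

Lemma continuous_eps {V : NormedModule R_AbsRing} (f : R -> V) (x : R) :
  continuous f x <-> forall eps, 0 < eps -> exists d, 0 < d /\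
    forall y, Rabs (y - x) < d -> norm (minus (f y) (f x)) < eps.
Proof.
split.
- intros H eps He.
  destruct (proj1 (filterlim_locally_ball_norm f (f x)) H (mkposreal _ He)) as [d Hd].
  exists d; split; [apply cond_pos|exact Hd].
- intros H; apply (filterlim_locally_ball_norm f (f x)); intros e.
  destruct (H e (cond_pos e)) as [d [Hd Hy]].
  exists (mkposreal d Hd); exact Hy.
Qed.

Lemma is_derive_eps {V : NormedModule R_AbsRing} (f : R -> V) (x : R) (l : V) :
  is_derive f x l <-> forall eps, 0 < eps -> exists d, 0 < d /\
    forall y, Rabs (y - x) < d ->
    norm (minus (minus (f y) (f x)) (scal (y - x) l)) <= eps * Rabs (y - x).
Proof.
split.
- intros [_ H] eps He.
  destruct (H x (fun P K => K) (mkposreal _ He)) as [d Hd].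
  exists d; split; [apply cond_pos|exact Hd].
- intros H; split; [apply is_linear_scal_l|].
  intros z Hz e; rewrite <- (is_filter_lim_locally_unique _ _ Hz).
  destruct (H e (cond_pos e)) as [d [Hd Hy]].
  exists (mkposreal d Hd); exact Hy.
Qed.

Lemma is_derive_continuous {V : NormedModule R_AbsRing} (f : R -> V) (x : R) (l : V) :
  is_derive f x l -> continuous f x.
Proof. intros H; apply ex_derive_continuous; now exists l. Qed.

Lemma ex_RInt_cont {V : CompleteNormedModule R_AbsRing} (f : R -> V) (a b : R) :
  (forall t, continuous f t) -> ex_RInt f a b.
Proof. intros H; apply ex_RInt_continuous; auto. Qed.

Lemma is_derive_RInt_cont {V : CompleteNormedModule R_AbsRing} (f : R -> V) (a t : R) :
  (forall s, continuous f s) -> is_derive (fun x => RInt f a x) t (f t).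
Proof.
intros H; apply is_derive_RInt with a; auto.
apply filter_forall; intros b; now apply RInt_correct, ex_RInt_cont.
Qed.

(** L commutes with Riemann sums and, being bounded, passes to their limit. *)
Lemma is_linear_RInt {V W : NormedModule R_AbsRing} (L : V -> W) (f : R -> V) (a b : R) (l : V) :
  is_linear L -> is_RInt f a b l -> is_RInt (fun x => L (f x)) a b (L l).
Proof.
intros HL H; unfold is_RInt in *.
eapply filterlim_ext; [|eapply filterlim_comp; [exact H|apply (linear_cont L l HL)]].
intros ptd; simpl; rewrite (linear_scal L HL); f_equal.
induction ptd as [x0|[x0 y0] s IH] using SF_cons_ind.
- apply (linear_zero L HL).
- now rewrite !Riemann_sum_cons, (linear_plus L HL), (linear_scal L HL), IH.
Qed.

Lemma RInt_linear {V W : CompleteNormedModule R_AbsRing} (L : V -> W) (f : R -> V) (a b : R) :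
  is_linear L -> (forall t, continuous f t) -> RInt (fun x => L (f x)) a b = L (RInt f a b).
Proof.
intros HL H; apply is_RInt_unique, is_linear_RInt; auto.
now apply RInt_correct, ex_RInt_cont.
Qed.

Lemma norm_minus_sym {V : NormedModule R_AbsRing} (x y : V) : norm (minus x y) = norm (minus y x).
Proof. rewrite <- norm_opp; now rewrite opp_minus. Qed.

Lemma minus_eq_zero_inv {V : AbelianGroup} (x y : V) : minus x y = zero -> x = y.
Proof.
intros H; transitivity (plus (minus x y) y).
- now unfold minus; rewrite <- plus_assoc, plus_opp_l, plus_zero_r.
- rewrite H; apply plus_zero_l.
Qed.

Lemma minus_plus_cancel_l {V : AbelianGroup} (x y : V) : minus (plus x y) x = y.
Proof.
unfold minus; rewrite (plus_comm x), <- plus_assoc.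
etransitivity; [apply (f_equal (plus y)), plus_opp_r|apply plus_zero_r].
Qed.

(* [norm (minus x y)] elaborates along different canonical paths over
   [NormedModule] and [CompleteNormedModule]; a constant keeps it syntactically unique. *)
Definition ndist {V : NormedModule R_AbsRing} (x y : V) : R := norm (minus x y).

Lemma ndist_ge_0 {V : NormedModule R_AbsRing} (x y : V) : 0 <= ndist x y.
Proof. apply norm_ge_0. Qed.

Lemma ndist_refl {V : NormedModule R_AbsRing} (x : V) : ndist x x = 0.
Proof. unfold ndist; rewrite minus_eq_zero; exact (norm_zero (V := V)). Qed.

Lemma ndist_sym {V : NormedModule R_AbsRing} (x y : V) : ndist x y = ndist y x.
Proof. apply norm_minus_sym. Qed.

Lemma ndist_triangle {V : NormedModule R_AbsRing} (y x z : V) : ndist x z <= ndist x y + ndist y z.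
Proof. unfold ndist; rewrite (minus_trans y); apply norm_triangle. Qed.

Lemma ndist_eq_0 {V : NormedModule R_AbsRing} (x y : V) : ndist x y = 0 -> x = y.
Proof.
intros H; apply minus_eq_zero_inv; exact (norm_eq_zero (V := V) _ H).
Qed.

Lemma minus_plus_l {V : AbelianGroup} (x y z : V) : minus (plus x y) (plus x z) = minus y z.
Proof.
unfold minus; rewrite opp_plus, (plus_comm x), <- plus_assoc.
now rewrite (plus_assoc x (opp x)), plus_opp_r, plus_zero_l.
Qed.

(* With the weight exp (K |t|) one integration gains the factor 1 / K on the whole
   line, so that the Picard iteration converges globally. *)
Lemma norm_RInt_exp_le {V : CompleteNormedModule R_AbsRing} (f : R -> V) (C K t : R) :
  0 < K -> (forall s, continuous f s) ->
  (forall s, norm (f s) <= C * exp (K * Rabs s)) ->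
  norm (RInt f 0 t) <= C / K * exp (K * Rabs t).
Proof.
intros HK.
assert (P : forall (g : R -> V) s, 0 <= s -> (forall s, continuous g s) ->
   (forall s, norm (g s) <= C * exp (K * Rabs s)) ->
   norm (RInt g 0 s) <= C / K * exp (K * Rabs s)).
{ intros g s Hs Hc Hg.
  assert (HC : 0 <= C).
  { specialize (Hg 0); rewrite Rabs_R0, Rmult_0_r, exp_0 in Hg.
    pose proof (norm_ge_0 (g 0)); lra. }
  assert (I : is_RInt (fun x => C * exp (K * x)) 0 s
     (minus (C / K * exp (K * s)) (C / K * exp (K * 0)))).
  { apply (is_RInt_derive (fun x => C / K * exp (K * x))); intros x _.
    - auto_derive; [trivial|field; lra].
    - apply (is_derive_continuous _ _ (C * (K * exp (K * x)))).
      auto_derive; [trivial|ring]. }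
  eapply Rle_trans.
  - eapply norm_RInt_le with (2 := fun x Hx => _) (4 := I); auto.
    apply RInt_correct, ex_RInt_cont; auto.
  - rewrite (Rabs_pos_eq s) by auto.
    change (C / K * exp (K * s) - C / K * exp (K * 0) <= C / K * exp (K * s)).
    rewrite Rmult_0_r, exp_0.
    assert (0 <= C / K) by (apply Rdiv_le_0_compat; lra); lra.
  Unshelve.
  simpl; eapply Rle_trans; [apply Hg|rewrite Rabs_pos_eq by lra; lra]. }
intros Hc Hf; destruct (Rle_dec 0 t) as [Ht|Ht]; [now apply P|].
(* The bound depends on s only through |s|, so a negative endpoint reduces to a positive one by the
   reflection of s to -s. *)
assert (E : RInt f 0 t = opp (RInt (fun s => f (- s)) 0 (- t))).
{ apply is_RInt_unique.
  assert (Q : is_RInt f (- 0) (- - t) (RInt f 0 t)).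
  { rewrite Ropp_0, Ropp_involutive; now apply RInt_correct, ex_RInt_cont. }
  apply is_RInt_comp_opp in Q.
  apply is_RInt_opp in Q.
  rewrite <- (opp_opp (RInt f 0 t)) in Q at 1.
  rewrite (is_RInt_unique (fun s => f (- s)) 0 (- t) (opp (RInt f 0 t))).
  - rewrite opp_opp; now apply RInt_correct, ex_RInt_cont.
  - rewrite opp_opp in Q; eapply is_RInt_ext; [|exact Q]; simpl; intros x _; now rewrite opp_opp. }
rewrite E; eapply Rle_trans; [right; apply (norm_opp (V := V))|].
rewrite <- (Rabs_Ropp t); apply P; [lra| |].
- intros s; apply (continuous_comp (fun s => - s) f); auto.
  apply (is_derive_continuous _ _ (-1)); auto_derive; auto.
- intros s; rewrite <- (Rabs_Ropp s); apply Hf.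
Qed.

(** Increments are compared with the single time t along the curve, not between arbitrary points of
    V: the power nonlinearity admits such a bound only on balls. *)
Lemma continuous_of_lipschitz {V W : NormedModule R_AbsRing} (K : R) (u : R -> V) (v : R -> W) t :
  (forall s, ndist (v s) (v t) <= K * ndist (u s) (u t)) -> continuous u t -> continuous v t.
Proof.
intros HG Hu; apply continuous_eps; intros e He.
pose proof (Rabs_pos K) as PK.
destruct (proj1 (continuous_eps u t) Hu (e / (Rabs K + 1))) as [d [Hd H]].
{ apply Rdiv_lt_0_compat; lra. }
exists d; split; auto; intros y Hy; specialize (H y Hy); fold (ndist (u y) (u t)) in H.
pose proof (ndist_ge_0 (u y) (u t)) as N.
apply Rle_lt_trans with (1 := HG _).
apply Rle_lt_trans with ((Rabs K + 1) * ndist (u y) (u t)).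
- apply Rmult_le_compat_r; auto; pose proof (Rle_abs K); lra.
- apply Rmult_lt_compat_l with (r := Rabs K + 1) in H; [|lra].
  replace ((Rabs K + 1) * (e / (Rabs K + 1))) with e in H by (field; lra); exact H.
Qed.

Lemma lipschitz_continuous {V W : NormedModule R_AbsRing} (G : V -> W) (K : R) (u : R -> V) t :
  (forall x y, ndist (G x) (G y) <= K * ndist x y) ->
  continuous u t -> continuous (fun s => G (u s)) t.
Proof. intros HG; apply continuous_of_lipschitz with K; intros s; apply HG. Qed.

(** The error bound grows with s, so convergence is only locally uniform; continuity of [b] bounds
    it by [b t + 1] near t, and one index n then serves the whole neighbourhood. *)
Lemma uniform_limit_continuous {V : NormedModule R_AbsRing} (un : nat -> R -> V) (u : R -> V)
    (b : R -> R) (t : R) :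
  (forall n s, ndist (u s) (un n s) <= (/ 2) ^ n * b s) ->
  (forall n, continuous (un n) t) -> continuous b t -> continuous u t.
Proof.
intros H Hn Hb; apply continuous_eps; intros e He.
destruct (proj1 (continuous_eps (V := R_NormedModule) b t) Hb 1 Rlt_0_1) as [d1 [Hd1 H1]].
assert (Pb : 0 <= b t).
{ pose proof (ndist_ge_0 (u t) (un O t)); specialize (H O t); simpl in H; lra. }
destruct (pow_lt_1_zero (/ 2)) with (y := e / (4 * (b t + 1))) as [n Hn0].
{ rewrite Rabs_pos_eq; lra. }
{ apply Rdiv_lt_0_compat; lra. }
specialize (Hn0 n (le_n n)); rewrite Rabs_pos_eq in Hn0 by (apply pow_le; lra).
destruct (proj1 (continuous_eps (un n) t) (Hn n) (e / 2)) as [d2 [Hd2 H2]]; [lra|].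
assert (P : forall s, b s <= b t + 1 -> ndist (u s) (un n s) <= e / 4).
{ intros s Hs; apply Rle_trans with (1 := H n s).
  apply Rle_trans with ((/ 2) ^ n * (b t + 1)).
  - apply Rmult_le_compat_l; auto; apply pow_le; lra.
  - replace (e / 4) with (e / (4 * (b t + 1)) * (b t + 1)) by (field; lra).
    apply Rmult_le_compat_r; lra. }
exists (Rmin d1 d2); split; [now apply Rmin_pos|]; intros y Hy.
specialize (H1 y (Rlt_le_trans _ _ _ Hy (Rmin_l _ _))).
specialize (H2 y (Rlt_le_trans _ _ _ Hy (Rmin_r _ _))); fold (ndist (un n y) (un n t)) in H2.
change (Rabs (b y - b t) < 1) in H1; apply Rabs_def2 in H1.
pose proof (P y ltac:(lra)) as Q1; pose proof (P t ltac:(lra)) as Q2.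
fold (ndist (u y) (u t)); rewrite ndist_sym in Q2.
pose proof (ndist_triangle (un n y) (u y) (u t)).
pose proof (ndist_triangle (un n t) (un n y) (u t)); lra.
Qed.

Lemma geometric_cauchy {V : CompleteNormedModule R_AbsRing} (a : nat -> V) (c : R) :
  (forall n, ndist (a (S n)) (a n) <= c * (/ 2) ^ n) ->
  exists l, forall n, ndist l (a n) <= (/ 2) ^ n * (2 * c).
Proof.
intros H.
assert (Hc : 0 <= c).
{ specialize (H O); simpl in H; pose proof (ndist_ge_0 (a 1%nat) (a O)); lra. }
assert (D : forall n k, ndist (a (n + k)%nat) (a n) <= (/ 2) ^ n * (2 * c)).
(* The claim itself is not inductive in k. The sharper bound is, because c / 2^m = 2c (2^-m -
   2^-(m+1)) telescopes. *)
{ assert (D : forall n k, ndist (a (n + k)%nat) (a n) <=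
     2 * c * ((/ 2) ^ n - (/ 2) ^ (n + k))).
  { intros n k; induction k as [|k IH].
    - rewrite Nat.add_0_r, ndist_refl; lra.
    - rewrite Nat.add_succ_r; pose proof (ndist_triangle (a (n + k)%nat) (a (S (n + k))) (a n)).
      specialize (H (n + k)%nat); simpl; lra. }
  intros n k; eapply Rle_trans; [apply D|].
  assert (0 <= (/ 2) ^ (n + k)) by (apply pow_le; lra); nra. }
destruct (proj1 (filterlim_locally_cauchy (F := eventually) a)) as [l Hl].
{ intros e; destruct (pow_lt_1_zero (/ 2)) with (y := e / 2 / (2 * c + 1)) as [N HN].
  { rewrite Rabs_pos_eq; lra. }
  { pose proof (cond_pos e); apply Rdiv_lt_0_compat; lra. }
  specialize (HN N (le_n N)); rewrite Rabs_pos_eq in HN by (apply pow_le; lra).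
  assert (HN' : (/ 2) ^ N * (2 * c) < e / 2).
  { apply Rle_lt_trans with ((/ 2) ^ N * (2 * c + 1)).
    - apply Rmult_le_compat_l; [apply pow_le|]; lra.
    - replace (e / 2) with (e / 2 / (2 * c + 1) * (2 * c + 1)) by (field; lra).
      apply Rmult_lt_compat_r; lra. }
  exists (fun n => (N <= n)%nat); split; [now exists N|].
  assert (Q : forall i, (N <= i)%nat -> ndist (a i) (a N) < e / 2).
  { intros i Hi; replace i with (N + (i - N))%nat by lia.
    eapply Rle_lt_trans; [apply D|exact HN']. }
  intros i j Hi Hj; apply (norm_compat1 (V := V)).
  pose proof (Q i Hi) as Qi; pose proof (Q j Hj) as Qj.
  pose proof (ndist_triangle (a N) (a j) (a i)) as T; rewrite (ndist_sym (a N)) in T.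
  apply Rle_lt_trans with (1 := T); lra. }
exists l; intros n; apply le_epsilon; intros e He.
destruct (proj1 (filterlim_locally_ball_norm a l) Hl (mkposreal e He)) as [N HN].
specialize (HN (n + N)%nat ltac:(lia)).
change (ndist (a (n + N)%nat) l < e) in HN.
pose proof (ndist_triangle (a (n + N)%nat) l (a n)) as T.
rewrite ndist_sym in HN; specialize (D n N); lra.
Qed.

Lemma ndist_RInt {V : CompleteNormedModule R_AbsRing} (x0 : V) (f g : R -> V) (a b : R) :
  (forall t, continuous f t) -> (forall t, continuous g t) ->
  ndist (plus x0 (RInt f a b)) (plus x0 (RInt g a b)) =
  norm (RInt (fun s => minus (f s) (g s)) a b).
Proof.
intros Hf Hg; etransitivity; [apply (f_equal norm), (minus_plus_l (V := V))|].
symmetry; apply (f_equal norm).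
apply RInt_minus; now apply ex_RInt_cont.
Qed.

(** Measured with the weight exp (2K|t|), one iteration contracts by K / (2K) = 1/2 on the whole
    line, so the solution is global at once and no local pieces are glued. *)
Lemma picard_lindelof {V : CompleteNormedModule R_AbsRing} (G : V -> V) (K : R) (x0 : V) :
  0 < K -> (forall x y, ndist (G x) (G y) <= K * ndist x y) ->
  exists u : R -> V, u 0 = x0 /\ forall t, is_derive u t (G (u t)).
Proof.
intros HK HG.
set (un := fix un n t := match n with O => x0
  | S n => plus x0 (RInt (fun s => G (un n s)) 0 t) end).
assert (Hc : forall n t, continuous (un n) t).
{ induction n as [|n IH]; intros t; [apply continuous_const|].
  simpl; apply (continuous_plus (fun _ => x0)); [apply continuous_const|].
  eapply is_derive_continuous, is_derive_RInt_cont; intros s.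
  now apply (lipschitz_continuous (V := V) (W := V) G K). }
(* The first iterate moves by |t| norm (G x0) = c (2K|t|), which is at most c exp (2K|t|). *)
set (c := norm (G x0) / (2 * K)).
assert (Hd : forall n t, ndist (un (S n) t) (un n t) <= c * (/ 2) ^ n * exp (2 * K * Rabs t)).
{ induction n as [|n IH]; intros t.
  - simpl; rewrite RInt_const.
    replace (ndist _ x0) with (norm (scal (t - 0) (G x0))).
    2: { symmetry; apply (f_equal norm), (minus_plus_cancel_l (V := V)). }
    eapply Rle_trans; [apply (norm_scal (V := V))|].
    change (abs (t - 0)) with (Rabs (t - 0)); rewrite Rminus_0_r.
    replace (Rabs t * norm (G x0)) with (c * (2 * K * Rabs t)) by (unfold c; field; lra).
    rewrite Rmult_1_r; apply Rmult_le_compat_l.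
    + apply Rdiv_le_0_compat; [apply norm_ge_0|lra].
    + pose proof (exp_ineq1_le (2 * K * Rabs t)); lra.
  - set (f := fun s => minus (G (un (S n) s)) (G (un n s))).
    replace (ndist (un (S (S n)) t) (un (S n) t)) with (norm (RInt f 0 t)).
    + replace (c * (/ 2) ^ S n) with (K * (c * (/ 2) ^ n) / (2 * K)) by (simpl; field; lra).
      apply norm_RInt_exp_le; [lra| |].
      * intros s; apply (continuous_minus (fun s => G (un (S n) s)));
          now apply (lipschitz_continuous (V := V) (W := V) G K).
      * intros s; eapply Rle_trans; [apply HG|].
        rewrite Rmult_assoc; apply Rmult_le_compat_l; [lra|apply IH].
    + symmetry; apply ndist_RInt; intros s;
        now apply (lipschitz_continuous (V := V) (W := V) G K). }
set (b := fun t => 2 * (c * exp (2 * K * Rabs t))).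
assert (Hu : forall t, exists l, forall n, ndist l (un n t) <= (/ 2) ^ n * b t).
{ intros t; apply geometric_cauchy; intros n; specialize (Hd n t); lra. }
destruct (choice _ Hu) as [u Hu']; clear Hu.
assert (Hb : forall t, continuous b t).
{ intros t; unfold b.
  apply (continuous_scal_r 2 (fun t => c * exp (2 * K * Rabs t))).
  apply (continuous_scal_r c (fun t => exp (2 * K * Rabs t))).
  apply continuous_comp; [|apply (is_derive_continuous _ _ (exp (2 * K * Rabs t)));
    auto_derive; auto; ring].
  apply (continuous_scal_r (2 * K) Rabs); apply continuous_Rabs. }
assert (Hcu : forall t, continuous u t).
{ intros t; now apply uniform_limit_continuous with un b. }
assert (HI : forall t, u t = plus x0 (RInt (fun s => G (u s)) 0 t)).
{ intros t.
  (* Both points lie within 2^-(n+1) b t of the iterate [un (S n) t]: the first by the choice of u,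
     the second by the weighted integral bound applied to G (un n) - G u. *)
  assert (Q : forall n, ndist (u t) (plus x0 (RInt (fun s => G (u s)) 0 t)) <=
     (/ 2) ^ n * b t).
  { intros n.
    set (f := fun s => minus (G (un n s)) (G (u s))).
    eapply Rle_trans; [apply (ndist_triangle (un (S n) t))|].
    replace (ndist (un (S n) t) (plus x0 (RInt (fun s => G (u s)) 0 t))) with (norm (RInt f 0 t)).
    - pose proof (Hu' t (S n)) as Q1.
      assert (Q2 : norm (RInt f 0 t) <= K * (2 * c * (/ 2) ^ n) / (2 * K) * exp (2 * K * Rabs t)).
      { apply norm_RInt_exp_le; [lra| |].
        - intros s; apply (continuous_minus (fun s => G (un n s)));
            now apply (lipschitz_continuous (V := V) (W := V) G K).
        - intros s; eapply Rle_trans; [apply HG|].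
          rewrite Rmult_assoc; apply Rmult_le_compat_l; [lra|].
          rewrite ndist_sym; specialize (Hu' s n); unfold b in Hu'; lra. }
      replace (K * (2 * c * (/ 2) ^ n) / (2 * K)) with (c * (/ 2) ^ n) in Q2 by (field; lra).
      unfold b in *; rewrite <- tech_pow_Rmult in Q1; lra.
    - symmetry; apply ndist_RInt; intros s;
        now apply (lipschitz_continuous (V := V) (W := V) G K). }
  apply ndist_eq_0, Rle_antisym; [|apply ndist_ge_0].
  assert (L : is_lim_seq (fun n => (/ 2) ^ n * b t) (Rbar_mult 0 (b t))).
  { apply is_lim_seq_scal_r, is_lim_seq_geom; rewrite Rabs_pos_eq; lra. }
  pose proof (is_lim_seq_le _ _ _ _ Q (is_lim_seq_const _) L) as Q0.
  simpl in Q0; lra. }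
exists u; split.
- rewrite HI, RInt_point; apply plus_zero_r.
- intros t; eapply is_derive_ext; [intros s; symmetry; apply HI|].
  rewrite <- (plus_zero_l (G (u t))).
  apply (is_derive_plus (fun _ => x0)); [apply (is_derive_const x0)|].
  apply (is_derive_RInt_cont (fun s => G (u s)));
    intros s; now apply (lipschitz_continuous (V := V) (W := V) G K).
Qed.

(** * The Hilbert space structure of L^2_h *)

Lemma Zsummable_le (a b : Z -> R) :
  (forall m, Rabs (a m) <= b m) -> Zsummable b -> Zsummable a.
Proof.
intros H; apply (ex_series_le (V := R_CompleteNormedModule)).
intros n; unfold zpair; eapply Rle_trans; [apply Rabs_triang|].
apply Rplus_le_compat; apply H.
Qed.

Lemma Zsummable_plus (a b : Z -> R) :
  Zsummable a -> Zsummable b -> Zsummable (fun m => a m + b m).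
Proof.
intros Ha Hb; eapply ex_series_ext; [|apply (ex_series_plus _ _ Ha Hb)].
intros n; unfold zpair; change plus with Rplus; simpl; ring.
Qed.

Lemma Zsummable_scal (c : R) (a : Z -> R) : Zsummable a -> Zsummable (fun m => c * a m).
Proof.
intros Ha; eapply ex_series_ext; [|apply (ex_series_scal_l c _ Ha)].
intros n; unfold zpair; change scal with Rmult; simpl; ring.
Qed.

Lemma Zsum_plus (a b : Z -> R) : Zsummable a -> Zsummable b ->
  Zsum (fun m => a m + b m) = Zsum a + Zsum b.
Proof.
intros Ha Hb; unfold Zsum; rewrite <- Series_plus by assumption.
apply Series_ext; intros n; unfold zpair; ring.
Qed.

Lemma Zsum_scal (c : R) (a : Z -> R) : Zsum (fun m => c * a m) = c * Zsum a.
Proof.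
unfold Zsum; rewrite <- Series_scal_l.
apply Series_ext; intros n; unfold zpair; ring.
Qed.

Lemma Zsum_le (a b : Z -> R) : (forall m, 0 <= a m <= b m) -> Zsummable b -> Zsum a <= Zsum b.
Proof.
intros H Hb; apply Series_le; auto; intros n; unfold zpair.
pose proof (H (Z.of_nat n)); pose proof (H (- Z.of_nat (S n))%Z); lra.
Qed.

Lemma Zsum_ge_0 (a : Z -> R) : (forall m, 0 <= a m) -> Zsummable a -> 0 <= Zsum a.
Proof.
intros H Ha; rewrite <- (Rmult_0_l (Zsum a)), <- Zsum_scal.
apply Zsum_le; auto; intros m; pose proof (H m); lra.
Qed.

Lemma Rabs_Zsum_le (a b : Z -> R) :
  (forall m, Rabs (a m) <= b m) -> Zsummable b -> Rabs (Zsum a) <= Zsum b.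
Proof.
intros H Hb.
assert (Ha : Zsummable a) by now apply Zsummable_le with b.
assert (P : forall c : R, Rabs c = 1 -> c * Zsum a <= Zsum b).
{ intros c Hc; rewrite <- Zsum_scal.
  assert (0 <= Zsum (fun m => b m + (- c) * a m)).
  { apply Zsum_ge_0.
    - intros m; pose proof (Rle_abs (c * a m)) as Q; rewrite Rabs_mult, Hc in Q.
      pose proof (H m); lra.
    - now apply Zsummable_plus, Zsummable_scal. }
  rewrite Zsum_plus, Zsum_scal in H0 by (auto; now apply Zsummable_scal).
  rewrite Zsum_scal; lra. }
apply Rabs_le; split.
- pose proof (P (-1) ltac:(rewrite Rabs_left; lra)); lra.
- pose proof (P 1 ltac:(rewrite Rabs_pos_eq; lra)); lra.
Qed.

(** Shifting changes a partial sum by two boundary terms. Absolute summability is what makes them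
    vanish: convergence of the paired sums of a alone would not force its individual values to 0. *)
Lemma Zsum_shift (a : Z -> R) :
  Zsummable (fun m => Rabs (a m)) -> Zsum (fun m => a (m + 1)%Z) = Zsum a.
Proof.
intros Ha.
assert (E : forall N, sum_n (zpair (fun m => a (m + 1)%Z)) N
            = sum_n (zpair a) N + (a (Z.of_nat (S N)) - a (- Z.of_nat (S N))%Z)).
{ induction N as [|N IH]; [rewrite !sum_O|rewrite !sum_Sn, IH]; unfold zpair.
  - simpl; ring.
  - replace (Z.of_nat (S N) + 1)%Z with (Z.of_nat (S (S N))) by lia.
    replace (- Z.of_nat (S (S N)) + 1)%Z with (- Z.of_nat (S N))%Z by lia.
    change (@plus R_AbelianMonoid) with Rplus; cbv beta.
    match goal with |- @eq _ ?x ?y => change (@eq R x y) end; ring. }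
assert (L : is_lim_seq (fun N => a (Z.of_nat (S N)) - a (- Z.of_nat (S N))%Z) 0).
{ pose proof (ex_series_lim_0 _ Ha) as L0.
  (* The boundary points -(n+1) and n+1 belong to two consecutive pairs, hence the sum of two terms
     of [zpair]. *)
  assert (L1 : is_lim_seq (fun n => zpair (fun m => Rabs (a m)) n +
    zpair (fun m => Rabs (a m)) (S n)) (0 + 0)).
  { apply is_lim_seq_plus'; [exact L0|now apply is_lim_seq_incr_1 in L0]. }
  apply is_lim_seq_abs_0; rewrite Rplus_0_l in L1.
  apply is_lim_seq_le_le with (3 := L1) (u := fun _ => 0); [|apply is_lim_seq_const].
  intros n; split; [apply Rabs_pos|]; unfold zpair.
  eapply Rle_trans; [apply Rabs_triang|rewrite Rabs_Ropp].
  pose proof (Rabs_pos (a (Z.of_nat n))); pose proof (Rabs_pos (a (- Z.of_nat (S (S n)))%Z)); lra. }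
apply is_series_unique.
assert (Q : Zsummable a) by (apply Zsummable_le with (2 := Ha); intros m; lra).
apply Series_correct in Q.
assert (L2 : is_lim_seq (sum_n (zpair (fun m => a (m + 1)%Z))) (Zsum a + 0)).
{ eapply is_lim_seq_ext; [intros N; symmetry; apply E|].
  apply is_lim_seq_plus'; [exact Q|exact L]. }
rewrite Rplus_0_r in L2; exact L2.
Qed.

(** The real part of conj z w, that is, the scalar product of C as R^2. *)
Definition cdot (z w : C) : R := fst z * fst w + snd z * snd w.

Lemma cdot_diag z : cdot z z = Cmod z * Cmod z.
Proof.
unfold Cmod; rewrite sqrt_sqrt; [unfold cdot; ring|].
apply Rplus_le_le_0_compat; apply pow2_ge_0.
Qed.

Lemma Rabs_cdot_le z w : Rabs (cdot z w) <= Cmod z * Cmod w.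
Proof.
apply Rsqr_incr_0; [|apply Rabs_pos|apply Rmult_le_pos; apply Cmod_ge_0].
rewrite <- Rsqr_abs; unfold Rsqr.
replace (Cmod z * Cmod w * (Cmod z * Cmod w)) with ((Cmod z * Cmod z) * (Cmod w * Cmod w)) by ring.
rewrite <- !cdot_diag; unfold cdot.
(* Lagrange's identity: this square is the defect in the Cauchy-Schwarz inequality. *)
pose proof (Rle_0_sqr (fst z * snd w - snd z * fst w)) as Q; unfold Rsqr in Q; lra.
Qed.

Lemma Zsummable_sq (f : Z -> C) : in_Lq 2 f -> Zsummable (fun m => Cmod (f m) * Cmod (f m)).
Proof. apply in_Lq2_eq. Qed.

Lemma Zsummable_mul (f g : Z -> C) : in_Lq 2 f -> in_Lq 2 g ->
  Zsummable (fun m => Cmod (f m) * Cmod (g m)).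
Proof.
intros Hf Hg; apply Zsummable_le with
  (fun m => Cmod (f m) * Cmod (f m) + Cmod (g m) * Cmod (g m)).
- intros m; rewrite Rabs_pos_eq by (apply Rmult_le_pos; apply Cmod_ge_0).
  pose proof (Rle_0_sqr (Cmod (f m) - Cmod (g m))) as Q; unfold Rsqr in Q.
  pose proof (Cmod_ge_0 (f m)); pose proof (Cmod_ge_0 (g m)); nra.
- now apply Zsummable_plus; apply Zsummable_sq.
Qed.

Lemma Zsummable_cdot (f g : Z -> C) : in_Lq 2 f -> in_Lq 2 g ->
  Zsummable (fun m => cdot (f m) (g m)).
Proof.
intros Hf Hg; apply Zsummable_le with (2 := Zsummable_mul f g Hf Hg).
intros m; apply Rabs_cdot_le.
Qed.

(* The real part of the complex inner product of L^2_h. *)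
Definition ip {h : posreal} (f g : L2 h) : R := h * Zsum (fun m => cdot (f m) (g m)).

Ltac l2ring := apply L2_ext; let m := fresh "m" in intros m;
  unfold minus; simpl; repeat rewrite ?RtoC_plus, ?RtoC_mult, ?RtoC_minus, ?RtoC_opp; try ring.

Lemma ip_sym {h : posreal} (f g : L2 h) : ip f g = ip g f.
Proof.
unfold ip; f_equal; f_equal; apply functional_extensionality; intros m; unfold cdot; ring.
Qed.

Lemma ip_plus_l {h : posreal} (f g k : L2 h) : ip (plus f g) k = ip f k + ip g k.
Proof.
unfold ip; rewrite <- Rmult_plus_distr_l; f_equal.
rewrite <- Zsum_plus by (apply Zsummable_cdot; apply L2_in).
f_equal; apply functional_extensionality; intros m; unfold cdot; simpl; ring.
Qed.

Lemma ip_scal_l {h : posreal} (a : R) (f g : L2 h) : ip (scal a f) g = a * ip f g.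
Proof.
unfold ip; transitivity (h * (a * Zsum (fun m => cdot (f m) (g m)))); [|ring].
rewrite <- (Zsum_scal a); f_equal.
f_equal; apply functional_extensionality; intros m; unfold cdot; simpl; ring.
Qed.

Lemma ip_opp_l {h : posreal} (f g : L2 h) : ip (opp f) g = - ip f g.
Proof.
replace (opp f) with (scal (-1) f) by l2ring; rewrite ip_scal_l; ring.
Qed.

Lemma L2_minusE {h : posreal} (f g : L2 h) : minus f g = plus f (opp g).
Proof. reflexivity. Qed.

Lemma ip_minus_l {h : posreal} (f g k : L2 h) : ip (minus f g) k = ip f k - ip g k.
Proof. rewrite L2_minusE, ip_plus_l, ip_opp_l; ring. Qed.

Lemma ip_plus_r {h : posreal} (f g k : L2 h) : ip k (plus f g) = ip k f + ip k g.
Proof. now rewrite ip_sym, ip_plus_l, !(ip_sym k). Qed.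

Lemma ip_scal_r {h : posreal} (a : R) (f g : L2 h) : ip g (scal a f) = a * ip g f.
Proof. now rewrite ip_sym, ip_scal_l, (ip_sym g). Qed.

Lemma ip_opp_r {h : posreal} (f g : L2 h) : ip g (opp f) = - ip g f.
Proof. now rewrite ip_sym, ip_opp_l, (ip_sym g). Qed.

Lemma ip_minus_r {h : posreal} (f g k : L2 h) : ip k (minus f g) = ip k f - ip k g.
Proof. now rewrite ip_sym, ip_minus_l, !(ip_sym k). Qed.

(** In real terms i is a skew operator; the conservation of mass and that of energy both come down
    to this. *)
Lemma ip_Ci_l {h : posreal} (f g : L2 h) : ip (L2_cscal Ci f) g = - ip f (L2_cscal Ci g).
Proof.
unfold ip; transitivity (h * (-1 * Zsum (fun m => cdot (f m) (L2_cscal Ci g m)))); [|ring].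
rewrite <- (Zsum_scal (-1)); f_equal.
f_equal; apply functional_extensionality; intros m; unfold cdot; simpl; ring.
Qed.

Lemma ip_Ci_diag {h : posreal} (f : L2 h) : ip f (L2_cscal Ci f) = 0.
Proof. pose proof (ip_Ci_l f f) as E; rewrite ip_sym in E; lra. Qed.

Lemma ip_diag {h : posreal} (f : L2 h) : ip f f = norm f ^ 2.
Proof.
pose proof (cond_pos h) as Hh.
change (norm f) with (Lq_norm h 2 f); rewrite Lq_norm2_eq by (apply L2_in || lra).
rewrite <- Rsqr_pow2, Rsqr_sqrt.
- unfold ip, Zsum; f_equal; f_equal; f_equal.
  apply functional_extensionality; intros m; apply cdot_diag.
- apply Rmult_le_pos; [lra|apply (Zsum_ge_0 (fun m => Cmod (f m) * Cmod (f m)))].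
  + intros m; apply Rle_0_sqr.
  + apply Zsummable_sq, L2_in.
Qed.

Lemma L2norm_triangle {h : posreal} (f g : L2 h) : norm (plus f g) <= norm f + norm g.
Proof. apply (L2_norm_triangle h). Qed.

Lemma L2norm_ge_0 {h : posreal} (f : L2 h) : 0 <= norm f.
Proof. apply (norm_ge_0 (V := L2_NormedModule h)). Qed.

Lemma L2norm_opp {h : posreal} (f : L2 h) : norm (opp f) = norm f.
Proof. apply (norm_opp (V := L2_NormedModule h)). Qed.

Lemma L2norm_le_minus {h : posreal} (f g : L2 h) : norm f <= norm (minus f g) + norm g.
Proof.
replace f with (plus (minus f g) g) at 1 by l2ring; apply L2norm_triangle.
Qed.

Lemma L2norm_minus_sym {h : posreal} (f g : L2 h) : norm (minus f g) = norm (minus g f).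
Proof. apply (norm_minus_sym (V := L2_NormedModule h)). Qed.

(** Cauchy-Schwarz read backwards from the triangle inequality, which the norm already satisfies:
    expand the square of norm (f + g). The sign is handled by replacing g with -g. *)
Lemma Rabs_ip_le {h : posreal} (f g : L2 h) : Rabs (ip f g) <= norm f * norm g.
Proof.
assert (P : forall g : L2 h, ip f g <= norm f * norm g).
{ intros k; pose proof (L2norm_triangle f k) as T.
  pose proof (L2norm_ge_0 f); pose proof (L2norm_ge_0 k); pose proof (L2norm_ge_0 (plus f k)).
  pose proof (ip_diag (plus f k)) as E.
  rewrite ip_plus_l, !ip_plus_r, (ip_sym k f), !ip_diag in E.
  assert (norm (plus f k) ^ 2 <= (norm f + norm k) ^ 2) by (apply pow_incr; lra).
  nra. }
pose proof (P g) as Q1; pose proof (P (opp g)) as Q2.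
rewrite ip_opp_r, L2norm_opp in Q2; apply Rabs_le; lra.
Qed.

Lemma is_linear_ip {h : posreal} (g : L2 h) :
  is_linear (U := L2_NormedModule h) (V := R_NormedModule) (fun f => ip f g).
Proof.
apply Build_is_linear.
- intros x y; apply ip_plus_l.
- intros k x; apply ip_scal_l.
- exists (norm g + 1); pose proof (L2norm_ge_0 g); split; [lra|].
  intros x; eapply Rle_trans; [apply Rabs_ip_le|].
  rewrite Rmult_comm; apply Rmult_le_compat_r; [apply L2norm_ge_0|lra].
Qed.

(** * Shifts and the discrete Laplacian *)

Definition shift_r {h : posreal} (f : L2 h) : L2 h := mkL2 h (in_L2_shift_r f (L2_in _ f)).
Definition shift_l {h : posreal} (f : L2 h) : L2 h := mkL2 h (in_L2_shift_l f (L2_in _ f)).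

Lemma ip_shift {h : posreal} (f g : L2 h) : ip (shift_r f) g = ip f (shift_l g).
Proof.
unfold ip; f_equal.
rewrite <- (Zsum_shift (fun m => cdot (f m) (shift_l g m))).
- f_equal; apply functional_extensionality; intros m; simpl.
  now replace (m + 1 - 1)%Z with m by lia.
- apply Zsummable_le with (2 := Zsummable_mul f (shift_l g) (L2_in _ _) (L2_in _ _)).
  intros m; rewrite Rabs_Rabsolu; apply Rabs_cdot_le.
Qed.

Lemma ip_shift_l {h : posreal} (f g : L2 h) : ip (shift_l f) g = ip f (shift_r g).
Proof. now rewrite ip_sym, <- ip_shift, ip_sym. Qed.

Lemma shift_lr {h : posreal} (f : L2 h) : shift_l (shift_r f) = f.
Proof. apply L2_ext; intros m; simpl; f_equal; lia. Qed.

Lemma shift_rl {h : posreal} (f : L2 h) : shift_r (shift_l f) = f.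
Proof. apply L2_ext; intros m; simpl; f_equal; lia. Qed.

Lemma norm_sq_inj {h : posreal} (f g : L2 h) : ip f f = ip g g -> norm f = norm g.
Proof.
rewrite !ip_diag; intros E.
pose proof (L2norm_ge_0 f); pose proof (L2norm_ge_0 g).
apply Rsqr_inj; auto; unfold Rsqr; lra.
Qed.

Lemma norm_shift_r {h : posreal} (f : L2 h) : norm (shift_r f) = norm f.
Proof. apply norm_sq_inj; now rewrite ip_shift, shift_lr. Qed.

Lemma norm_shift_l {h : posreal} (f : L2 h) : norm (shift_l f) = norm f.
Proof. apply norm_sq_inj; now rewrite <- ip_shift, shift_rl. Qed.

(** In terms of the two shifts, which are isometries and adjoint to each other, symmetry of Lap and
    the bound (1 + 1 + 2) / h^2 become algebra. *)
Lemma Lap_eq {h : posreal} (f : L2 h) :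
  Lap f = scal (/ h ^ 2) (minus (plus (shift_r f) (shift_l f)) (scal 2 f)).
Proof.
assert (Hh : (h ^ 2)%R <> 0) by (apply pow_nonzero; pose proof (cond_pos h); lra).
apply L2_ext; intros m; rewrite L2_minusE.
change (((f (m + 1)%Z + f (m - 1)%Z - 2 * f m) / (h ^ 2)%R)%C =
  (RtoC (/ h ^ 2) * ((f (m + 1)%Z + f (m - 1)%Z) + - (1) * (2 * f m)))%C).
rewrite RtoC_inv by exact Hh; unfold Cdiv; ring.
Qed.

Lemma Dplus_eq {h : posreal} (f : L2 h) : Dplus f = scal (/ h) (minus (shift_r f) f).
Proof.
apply L2_ext; intros m; rewrite L2_minusE.
change (((f (m + 1)%Z - f m) / h)%C = (RtoC (/ h) * (f (m + 1)%Z + - (1) * f m))%C).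
rewrite RtoC_inv by (pose proof (cond_pos h); lra); unfold Cdiv; ring.
Qed.

Lemma Lap_sym {h : posreal} (f g : L2 h) : ip (Lap f) g = ip f (Lap g).
Proof.
rewrite !Lap_eq, ip_scal_l, ip_scal_r, ip_minus_l, ip_minus_r, ip_plus_l, ip_plus_r, ip_scal_l,
  ip_scal_r, ip_shift, ip_shift_l; ring.
Qed.

(** Summation by parts: with S the shift, |Sf - f|^2 = 2|f|^2 - 2<Sf, f> as S is an isometry, and
    the adjoint of S contributes the same product <Sf, f> on the right. *)
Lemma norm_Dplus_sq {h : posreal} (f : L2 h) : norm (Dplus f) ^ 2 = - ip (Lap f) f.
Proof.
pose proof (cond_pos h) as Hh.
rewrite <- ip_diag, Dplus_eq, Lap_eq, !ip_scal_l, ip_scal_r, !ip_minus_l, !ip_minus_r, ip_plus_l,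
  ip_scal_l, ip_shift_l, (ip_sym f (shift_r f)), (ip_shift f (shift_r f)), shift_lr.
field; lra.
Qed.

Lemma Lap_plus {h : posreal} (f g : L2 h) : Lap (plus f g) = plus (Lap f) (Lap g).
Proof. apply L2_ext; intros m; simpl; unfold lap_fun, Cdiv; simpl; ring. Qed.

Lemma Lap_cscal {h : posreal} (c : C) (f : L2 h) : Lap (L2_cscal c f) = L2_cscal c (Lap f).
Proof. apply L2_ext; intros m; simpl; unfold lap_fun, Cdiv; simpl; ring. Qed.

Lemma Lap_scal {h : posreal} (a : R) (f : L2 h) : Lap (scal a f) = scal a (Lap f).
Proof. apply Lap_cscal. Qed.

Lemma norm_cscal_le {h : posreal} (c : C) (f : L2 h) : norm (L2_cscal c f) <= Cmod c * norm f.
Proof. apply (L2_norm_cscal h). Qed.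

Lemma L2norm_scal {h : posreal} (a : R) (f : L2 h) : norm (scal a f) <= Rabs a * norm f.
Proof. apply (L2_norm_scal h). Qed.

Lemma norm_Lap_le {h : posreal} (f : L2 h) : norm (Lap f) <= 4 / h ^ 2 * norm f.
Proof.
pose proof (cond_pos h) as Hh.
assert (Hh2 : 0 < / h ^ 2) by (apply Rinv_0_lt_compat, pow_lt; lra).
rewrite Lap_eq; eapply Rle_trans; [apply L2norm_scal|].
rewrite Rabs_pos_eq by lra.
replace (4 / h ^ 2 * norm f) with (/ h ^ 2 * (4 * norm f)) by (unfold Rdiv; ring).
apply Rmult_le_compat_l; [lra|].
rewrite L2_minusE; eapply Rle_trans; [apply L2norm_triangle|rewrite L2norm_opp].
pose proof (L2norm_triangle (shift_r f) (shift_l f)) as T.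
rewrite norm_shift_r, norm_shift_l in T.
pose proof (L2norm_scal 2 f) as T2; rewrite Rabs_pos_eq in T2 by lra; lra.
Qed.

Lemma is_linear_Lap {h : posreal} : is_linear (U := L2_NormedModule h) (V := L2_NormedModule h) Lap.
Proof.
pose proof (cond_pos h) as Hh.
apply Build_is_linear.
- apply Lap_plus.
- apply Lap_scal.
- exists (4 / h ^ 2); split; [apply Rdiv_lt_0_compat, pow_lt; lra|apply norm_Lap_le].
Qed.

Lemma cscal_plus {h : posreal} (c : C) (f g : L2 h) :
  L2_cscal c (plus f g) = plus (L2_cscal c f) (L2_cscal c g).
Proof. l2ring. Qed.

Lemma is_linear_cscal {h : posreal} (c : C) :
  is_linear (U := L2_NormedModule h) (V := L2_NormedModule h) (L2_cscal c).
Proof.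
apply Build_is_linear.
- apply cscal_plus.
- intros k x; l2ring.
- pose proof (Cmod_ge_0 c).
  exists (Cmod c + 1); split; [lra|]; intros x; eapply Rle_trans; [apply norm_cscal_le|].
  apply Rmult_le_compat_r; [apply L2norm_ge_0|lra].
Qed.

(** * Differentiation along curves and conserved quantities *)

Lemma is_linear_is_derive {V W : NormedModule R_AbsRing} (L : V -> W) (u : R -> V) (t : R) (l : V) :
  is_linear L -> is_derive u t l -> is_derive (fun s => L (u s)) t (L l).
Proof.
intros HL Hu; unfold is_derive.
eapply filterdiff_ext_lin.
- apply filterdiff_comp' with (f := u) (g := L); [exact Hu|now apply filterdiff_linear].
- intros y; simpl; apply (linear_scal L HL).
Qed.

(** Chain rule for a functional with gradient g at u t. The quadratic remainder is demanded only
    within distance 1, so that its constant may depend on the size of u t. *)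
Lemma is_derive_chain {h : posreal} (Phi : L2 h -> R) (u : R -> L2 h) (t C : R) (g l : L2 h) :
  (forall w, norm (minus w (u t)) <= 1 ->
     Rabs (Phi w - Phi (u t) - ip g (minus w (u t))) <= C * norm (minus w (u t)) ^ 2) ->
  is_derive u t l -> is_derive (fun s => Phi (u s)) t (ip g l).
Proof.
intros H Hu.
apply (is_derive_eps (V := R_NormedModule)); intros e He.
assert (HC : 0 <= Rabs C) by apply Rabs_pos.
pose proof (L2norm_ge_0 g) as Hg; pose proof (L2norm_ge_0 l) as Hl.
set (B := norm l + 1).
destruct (proj1 (is_derive_eps (V := L2_NormedModule h) u t l) Hu 1 Rlt_0_1) as [d1 [Hd1 H1]].
destruct (proj1 (is_derive_eps (V := L2_NormedModule h) u t l) Hu (e / (2 * (norm g + 1))))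
  as [d2 [Hd2 H2]]; [apply Rdiv_lt_0_compat; lra|].
assert (Hq : 0 < e / (2 * ((Rabs C + 1) * B * B))).
{ apply Rdiv_lt_0_compat; auto; unfold B; repeat apply Rmult_lt_0_compat; lra. }
assert (Hb : 0 < / B) by (apply Rinv_0_lt_compat; unfold B; lra).
(* [d1] gives the slope bound B, [d2] makes the linear error at most half of e, [/ B] keeps u y
   within distance 1, and the last threshold makes the quadratic term at most the other half. *)
exists (Rmin (Rmin d1 d2) (Rmin (/ B) (e / (2 * ((Rabs C + 1) * B * B))))); split;
  [now repeat apply Rmin_pos|].
intros y Hy.
pose proof (Rmin_l (Rmin d1 d2) (Rmin (/ B) (e / (2 * ((Rabs C + 1) * B * B))))).
pose proof (Rmin_r (Rmin d1 d2) (Rmin (/ B) (e / (2 * ((Rabs C + 1) * B * B))))).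
pose proof (Rmin_l d1 d2); pose proof (Rmin_r d1 d2).
pose proof (Rmin_l (/ B) (e / (2 * ((Rabs C + 1) * B * B)))).
pose proof (Rmin_r (/ B) (e / (2 * ((Rabs C + 1) * B * B)))).
specialize (H1 y ltac:(lra)); specialize (H2 y ltac:(lra)).
assert (Ha : 0 <= Rabs (y - t)) by apply Rabs_pos.
set (dw := minus (u y) (u t)) in *; set (rem := minus dw (scal (y - t) l)) in *.
assert (Bd : norm dw <= B * Rabs (y - t)).
{ replace dw with (plus rem (scal (y - t) l)) by (unfold rem; l2ring).
  eapply Rle_trans; [apply L2norm_triangle|].
  change (norm rem <= 1 * Rabs (y - t)) in H1.
  pose proof (L2norm_scal (y - t) l); unfold B; lra. }
pose proof (L2norm_ge_0 dw) as Pd.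
assert (B1 : norm dw <= 1).
{ apply Rle_trans with (1 := Bd); replace 1 with (B * / B) by (field; unfold B; lra).
  apply Rmult_le_compat_l; [unfold B|]; lra. }
specialize (H (u y) B1).
change (Rabs (Phi (u y) - Phi (u t) - (y - t) * ip g l) <= e * Rabs (y - t)).
fold dw in H.
assert (E : ip g dw = ip g rem + (y - t) * ip g l).
{ rewrite <- ip_scal_r, <- ip_plus_r; f_equal; unfold rem; l2ring. }
rewrite E in H.
assert (Q1 : Rabs (ip g rem) <= e / 2 * Rabs (y - t)).
{ eapply Rle_trans; [apply Rabs_ip_le|].
  apply Rle_trans with ((norm g + 1) * norm rem).
  - apply Rmult_le_compat_r; [apply L2norm_ge_0|lra].
  - replace (e / 2) with ((norm g + 1) * (e / (2 * (norm g + 1)))) by (field; lra).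
    rewrite Rmult_assoc; apply Rmult_le_compat_l; [lra|exact H2]. }
assert (Q2 : C * norm dw ^ 2 <= e / 2 * Rabs (y - t)).
{ apply Rle_trans with ((Rabs C + 1) * norm dw ^ 2).
  { apply Rmult_le_compat_r; [apply pow2_ge_0|pose proof (Rle_abs C); lra]. }
  apply Rle_trans with ((Rabs C + 1) * (B * Rabs (y - t)) ^ 2).
  { apply Rmult_le_compat_l; [lra|apply pow_incr; lra]. }
  replace ((Rabs C + 1) * (B * Rabs (y - t)) ^ 2)
    with ((Rabs C + 1) * B * B * Rabs (y - t) * Rabs (y - t)) by ring.
  apply Rmult_le_compat_r; auto.
  replace (e / 2) with ((Rabs C + 1) * B * B * (e / (2 * ((Rabs C + 1) * B * B))))
    by (unfold B; field; lra).
  apply Rmult_le_compat_l; [unfold B; repeat apply Rmult_le_pos|]; lra. }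
replace (Phi (u y) - Phi (u t) - (y - t) * ip g l)
  with ((Phi (u y) - Phi (u t) - (ip g rem + (y - t) * ip g l)) + ip g rem) by ring.
eapply Rle_trans; [apply Rabs_triang|lra].
Qed.

Lemma is_derive_norm_sq {h : posreal} (u : R -> L2 h) (t : R) (l : L2 h) :
  is_derive u t l -> is_derive (fun s => norm (u s) ^ 2) t (2 * ip (u t) l).
Proof.
intros Hu; rewrite <- ip_scal_l.
(* For the squared norm the remainder is exactly the squared norm of the increment, hence the
   constant 1. *)
apply (is_derive_chain (fun w => norm w ^ 2)) with 1; auto.
intros w _; rewrite <- !ip_diag, ip_scal_l, !ip_minus_l, !ip_minus_r, (ip_sym (u t) w).
right; rewrite Rmult_1_l; unfold Rabs; destruct Rcase_abs; try ring.
exfalso; pose proof (pow2_ge_0 (norm (minus w (u t)))) as P.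
rewrite <- ip_diag, ip_minus_l, !ip_minus_r, (ip_sym (u t) w) in P; lra.
Qed.

Lemma constant_of_derive_0 (f : R -> R) : (forall t, is_derive f t 0) -> forall t, f t = f 0.
Proof.
intros H t; destruct (MVT_gen f 0 t (fun _ => 0)) as [c [_ Hc]].
- intros x _; apply H.
- intros x _; apply continuity_pt_filterlim; apply (is_derive_continuous f x 0), H.
- lra.
Qed.

Lemma norm_constant {h : posreal} (u du : R -> L2 h) :
  (forall t, is_derive u t (du t)) -> (forall t, ip (u t) (du t) = 0) ->
  forall t, norm (u t) = norm (u 0).
Proof.
intros H H0 t; apply norm_sq_inj; rewrite !ip_diag.
apply (constant_of_derive_0 (fun t => norm (u t) ^ 2)); intros s.
replace 0 with (2 * ip (u s) (du s)) by (rewrite H0; ring).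
now apply is_derive_norm_sq.
Qed.

(** * The Schroedinger group *)

(** [lim] is pinned down only on Cauchy filters. Convergence of the partial sums makes their filter
    Cauchy, and limits are unique. *)
Lemma vseries_unique {V : CompleteNormedModule R_AbsRing} (a : nat -> V) (l : V) :
  is_series a l -> vseries a = l.
Proof.
intros H; unfold vseries; symmetry.
apply (filterlim_locally_unique (F := eventually) (sum_n a)); [exact H|].
intros P [e He]; destruct (complete_cauchy (filtermap (sum_n a) eventually)) with (eps := e)
  as [N HN].
- apply filtermap_proper_filter, eventually_filter.
- intros d; exists l; apply H, locally_ball.
- exists N; intros n Hn; apply He, HN, Hn.
Qed.

Lemma norm_series_le {V : NormedModule R_AbsRing} (a : nat -> V) (b : nat -> R) (l : V) (s : R) :
  (forall n, norm (a n) <= b n) -> is_series a l -> is_series b s -> norm l <= s.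
Proof.
intros H Ha Hb.
assert (P : forall N, norm (sum_n a N) <= sum_n b N).
{ induction N as [|N IH]; [rewrite !sum_O; apply H|rewrite !sum_Sn].
  eapply Rle_trans; [apply norm_triangle|].
  apply Rplus_le_compat; [exact IH|apply H]. }
apply (filterlim_le (F := eventually) (fun N => norm (sum_n a N)) (sum_n b) (norm l) s).
- now apply filter_forall.
- eapply filterlim_comp; [exact Ha|apply filterlim_norm].
- exact Hb.
Qed.

Lemma is_series_exp (x : R) : is_series (fun k => x ^ k / INR (fact k)) (exp x).
Proof.
eapply is_series_ext; [|apply (is_exp_Reals x)].
intros k; simpl; change scal with Rmult; simpl.
rewrite pow_n_pow; unfold Rdiv; reflexivity.
Qed.

(** The derivative of x^k; the separate case k = 0 avoids an exponent k - 1. *)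
Definition dpow (x : R) (k : nat) : R :=
  match k with O => 0 | S j => INR (S j) * x ^ j end.

Lemma dpow_S (x : R) (k : nat) : dpow x (S k) = x * dpow x k + x ^ k.
Proof.
destruct k; [simpl; ring|].
unfold dpow; rewrite (S_INR (S k)); simpl pow; ring.
Qed.

Lemma dpow_Rabs (x : R) (k : nat) : Rabs (dpow x k) = dpow (Rabs x) k.
Proof.
destruct k; [apply Rabs_R0|]; unfold dpow.
rewrite Rabs_mult, RPow_abs, Rabs_pos_eq; [reflexivity|apply pos_INR].
Qed.

Definition pow_rem (r s : R) (k : nat) : R := (r + s) ^ k - r ^ k - s * dpow r k.

(* The first-order remainder of the operator exponential is thus dominated by that
   of the scalar exponential. *)
Lemma Rabs_pow_rem_le (r s : R) (k : nat) :
  Rabs (pow_rem r s k) <= pow_rem (Rabs r) (Rabs s) k.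
Proof.
(* The recursion has only nonnegative coefficients once x and y are replaced by their absolute
   values, so the triangle inequality can be applied at every step. *)
assert (E : forall x y j, pow_rem x y (S j) = (x + y) * pow_rem x y j + y * y * dpow x j).
{ intros x y j; unfold pow_rem; rewrite dpow_S; simpl pow; ring. }
induction k as [|k IH].
- unfold pow_rem; simpl; replace (1 - 1 - s * 0) with 0 by ring.
  rewrite Rabs_R0; lra.
- rewrite !E; eapply Rle_trans; [apply Rabs_triang|].
  rewrite !Rabs_mult, dpow_Rabs; apply Rplus_le_compat_r.
  apply Rmult_le_compat; auto using Rabs_pos, Rabs_triang.
Qed.

Lemma is_series_linear {V W : NormedModule R_AbsRing} (L : V -> W) (a : nat -> V) (l : V) :
  is_linear L -> is_series a l -> is_series (fun k => L (a k)) (L l).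
Proof.
intros HL H; unfold is_series in *.
eapply filterlim_ext; [|eapply filterlim_comp; [exact H|apply (linear_cont L l HL)]].
intros n; simpl; induction n as [|n IH].
- now rewrite !sum_O.
- now rewrite !sum_Sn, (linear_plus L HL), IH.
Qed.

(** Termwise differentiation of the exponential series is an index shift, since (k+1) / (k+1)! = 1 /
    k! and the term k = 0 vanishes. *)
Lemma is_series_dpow {V : NormedModule R_AbsRing} (a : nat -> V) (r : R) (l : V) :
  is_series (fun k => scal (r ^ k / INR (fact k)) (a (S k))) l ->
  is_series (fun k => scal (dpow r k / INR (fact k)) (a k)) l.
Proof.
intros H; apply is_series_decr_1.
replace (plus l _) with l.
- eapply is_series_ext; [|exact H]; intros k; simpl; f_equal.
  change (r ^ k / INR (fact k) = INR (S k) * r ^ k / INR (S k * fact k)).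
  rewrite mult_INR; field; split; [apply INR_fact_neq_0|apply not_0_INR; lia].
- assert (E : scal (dpow r 0 / INR (fact 0)) (a O) = zero).
  { etransitivity; [|apply (scal_zero_l (a O))].
    apply (f_equal (fun c => scal c (a O))); unfold dpow, Rdiv; apply Rmult_0_l. }
  rewrite E; symmetry; etransitivity; [apply (f_equal (plus l)), (opp_zero (G := V))|apply plus_zero_r].
Qed.

Definition iLap {h : posreal} (f : L2 h) : L2 h := L2_cscal Ci (Lap f).

Lemma is_linear_iLap {h : posreal} :
  is_linear (U := L2_NormedModule h) (V := L2_NormedModule h) iLap.
Proof.
apply (is_linear_comp (V := L2_NormedModule h) Lap); [apply is_linear_Lap|apply is_linear_cscal].
Qed.

Lemma iLap_plus {h : posreal} (f g : L2 h) : iLap (plus f g) = plus (iLap f) (iLap g).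
Proof. apply (linear_plus _ is_linear_iLap). Qed.

Lemma iLap_scal {h : posreal} (a : R) (f : L2 h) : iLap (scal a f) = scal a (iLap f).
Proof. apply (linear_scal _ is_linear_iLap). Qed.

Lemma iLap_minus {h : posreal} (f g : L2 h) : iLap (minus f g) = minus (iLap f) (iLap g).
Proof.
replace (minus f g) with (plus f (scal (-1) g)) by l2ring.
rewrite iLap_plus, iLap_scal; l2ring.
Qed.

(** Lap is symmetric and commutes with i, hence i Lap is skew: this is unitarity at the level of
    generators. *)
Lemma ip_iLap_diag {h : posreal} (f : L2 h) : ip f (iLap f) = 0.
Proof.
unfold iLap; pose proof (ip_Ci_l f (Lap f)) as E.
rewrite <- Lap_sym, Lap_cscal, (ip_sym _ f) in E; lra.
Qed.

Lemma Cmod_Ci : Cmod Ci = 1.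
Proof. transitivity (sqrt 1); [unfold Cmod, Ci; simpl; f_equal; ring|apply sqrt_1]. Qed.

Lemma norm_iLap_le {h : posreal} (f : L2 h) : norm (iLap f) <= 4 / h ^ 2 * norm f.
Proof.
unfold iLap; eapply Rle_trans; [apply norm_cscal_le|].
rewrite Cmod_Ci, Rmult_1_l; apply norm_Lap_le.
Qed.

Lemma norm_iter_iLap_le {h : posreal} (f : L2 h) (k : nat) :
  norm (Nat.iter k iLap f) <= (4 / h ^ 2) ^ k * norm f.
Proof.
pose proof (cond_pos h) as Hh.
assert (HM : 0 < 4 / h ^ 2) by (apply Rdiv_lt_0_compat; [lra|apply pow_lt; lra]).
induction k as [|k IH].
{ rewrite pow_O, Rmult_1_l; apply Rle_refl. }
rewrite <- tech_pow_Rmult, Rmult_assoc.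
eapply Rle_trans; [apply norm_iLap_le|].
apply Rmult_le_compat_l; [lra|exact IH].
Qed.

(** Pulling r^k out turns [Th r f] into a power series in r with fixed vectors as coefficients,
    which can be differentiated in r. *)
Lemma iter_cscal {h : posreal} (r : R) (f : L2 h) (k : nat) :
  Nat.iter k (fun g => L2_cscal (Ci * r)%C (Lap g)) f = scal (r ^ k) (Nat.iter k iLap f).
Proof.
induction k as [|k IH]; [simpl; l2ring|].
simpl Nat.iter; rewrite IH, Lap_scal; unfold iLap; simpl pow; l2ring.
Qed.

Lemma is_series_Th {h : posreal} (r : R) (f : L2 h) :
  is_series (V := L2_NormedModule h)
    (fun k => scal (r ^ k / INR (fact k)) (Nat.iter k iLap f)) (Th r f).
Proof.
destruct (ex_series_le (V := L2_CompleteNormedModule h)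
  (fun k => scal (r ^ k / INR (fact k)) (Nat.iter k iLap f))
  (fun k => norm f * ((Rabs r * (4 / h ^ 2)) ^ k / INR (fact k)))) as [l Hl].
- intros k; eapply Rle_trans; [apply (L2norm_scal (h := h))|].
  unfold Rdiv at 1; rewrite Rabs_mult, <- RPow_abs.
  assert (Hf : 0 < / INR (fact k)) by apply Rinv_0_lt_compat, INR_fact_lt_0.
  rewrite (Rabs_pos_eq (/ _)) by lra; rewrite Rpow_mult_distr.
  replace (norm f * (Rabs r ^ k * (4 / h ^ 2) ^ k / INR (fact k)))
    with (Rabs r ^ k * / INR (fact k) * ((4 / h ^ 2) ^ k * norm f)) by (unfold Rdiv; ring).
  apply Rmult_le_compat_l; [apply Rmult_le_pos; [apply pow_le, Rabs_pos|lra]|].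
  apply norm_iter_iLap_le.
- apply (ex_series_scal (V := R_NormedModule) (norm f : R)
    (fun k => (Rabs r * (4 / h ^ 2)) ^ k / INR (fact k))); eexists; apply is_series_exp.
- replace (Th r f) with l; [exact Hl|].
  unfold Th, op_exp; symmetry; apply (vseries_unique (V := L2_CompleteNormedModule h)).
  eapply is_series_ext; [|exact Hl]; intros k; simpl; rewrite iter_cscal; unfold Rdiv; l2ring.
Qed.

Lemma Th_0 {h : posreal} (f : L2 h) : Th 0 f = f.
Proof.
pose proof (is_series_Th 0 f) as H.
apply (filterlim_locally_unique (V := L2_NormedModule h) (F := eventually)
  (sum_n (fun k => scal (0 ^ k / INR (fact k)) (Nat.iter k iLap f)))); [exact H|].
(* Every partial sum equals f, because 0 ^ 0 = 1 and the higher powers of 0 vanish. *)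
eapply filterlim_ext; [|apply filterlim_const].
intros n; induction n as [|n IH].
- rewrite sum_O; simpl; l2ring. unfold Rdiv; rewrite Rinv_1, RtoC_mult; ring.
- rewrite sum_Sn, <- IH.
  simpl pow; unfold Rdiv; rewrite !Rmult_0_l; l2ring.
Qed.

Lemma is_derive_Th {h : posreal} (r : R) (f : L2 h) :
  is_derive (fun r => Th r f) r (iLap (Th r f)).
Proof.
pose proof (cond_pos h) as Hh.
set (M := 4 / h ^ 2).
assert (HM : 0 < M) by (apply Rdiv_lt_0_compat; [lra|apply pow_lt; lra]).
pose proof (L2norm_ge_0 f) as Hf.
set (a := Rabs r).
assert (Rem : forall s, norm (minus (minus (Th (r + s) f) (Th r f)) (scal s (iLap (Th r f)))) <=
   norm f * (exp ((a + Rabs s) * M) - exp (a * M) - Rabs s * (M * exp (a * M)))).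
{ intros s.
  assert (D : is_series (V := L2_NormedModule h)
    (fun k => scal (dpow r k / INR (fact k)) (Nat.iter k iLap f)) (iLap (Th r f))).
  { apply (is_series_dpow (V := L2_NormedModule h)).
    eapply is_series_ext; [|apply (is_series_linear (V := L2_NormedModule h) iLap);
      [apply is_linear_iLap|apply is_series_Th]].
    intros k; simpl; now rewrite iLap_scal. }
  assert (DR : is_series (fun k => dpow a k / INR (fact k) * M ^ k) (M * exp (a * M))).
  { apply (is_series_dpow (V := R_NormedModule) (fun k => M ^ k)).
    eapply is_series_ext; [|apply (is_series_scal (V := R_NormedModule) M), (is_series_exp (a * M))].
    intros k.
    change (M * ((a * M) ^ k / INR (fact k)) = a ^ k / INR (fact k) * M ^ S k).
    rewrite Rpow_mult_distr; simpl pow; unfold Rdiv; ring. }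
  apply (norm_series_le (V := L2_NormedModule h)
    (fun k => scal (pow_rem r s k / INR (fact k)) (Nat.iter k iLap f))
    (fun k => norm f * (pow_rem a (Rabs s) k / INR (fact k) * M ^ k))).
  - intros k; eapply Rle_trans; [apply (L2norm_scal (h := h))|].
    assert (Hk : 0 < / INR (fact k)) by apply Rinv_0_lt_compat, INR_fact_lt_0.
    unfold Rdiv; rewrite Rabs_mult, (Rabs_pos_eq (/ _)) by lra.
    replace (norm f * (pow_rem a (Rabs s) k * / INR (fact k) * M ^ k))
      with (pow_rem a (Rabs s) k * / INR (fact k) * (M ^ k * norm f)) by ring.
    apply Rmult_le_compat.
    + apply Rmult_le_pos; [apply Rabs_pos|lra].
    + apply L2norm_ge_0.
    + apply Rmult_le_compat_r; [lra|apply Rabs_pow_rem_le].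
    + apply norm_iter_iLap_le.
  - eapply is_series_ext; [|apply (is_series_minus (V := L2_NormedModule h)
      _ _ _ _ (is_series_minus _ _ _ _ (is_series_Th (r + s) f) (is_series_Th r f))
      (is_series_scal s _ _ D))].
    intros k; simpl; unfold pow_rem, Rdiv; l2ring.
  - apply (is_series_scal (V := R_NormedModule) (norm f : R)
      (fun k => pow_rem a (Rabs s) k / INR (fact k) * M ^ k)).
    eapply is_series_ext; [|apply (is_series_minus (V := R_NormedModule)
      _ _ _ _ (is_series_minus _ _ _ _ (is_series_exp ((a + Rabs s) * M)) (is_series_exp (a * M)))
      (is_series_scal (Rabs s) _ _ DR))].
    intros k.
    change (((a + Rabs s) * M) ^ k / INR (fact k) - (a * M) ^ k / INR (fact k)
      - Rabs s * (dpow a k / INR (fact k) * M ^ k) = pow_rem a (Rabs s) k / INR (fact k) * M ^ k).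
    rewrite !Rpow_mult_distr; unfold pow_rem, Rdiv; ring. }
apply (is_derive_eps (V := L2_NormedModule h)); intros e He.
(* The dominating scalar remainder is that of the exponential at a with increment |y - r|, so its
   smallness is the differentiability of this function at 0. *)
assert (DE : is_derive (fun s => exp ((a + s) * M)) 0 (M * exp (a * M))).
{ auto_derive; auto; rewrite Rplus_0_r; ring. }
destruct (proj1 (is_derive_eps (V := R_NormedModule) _ _ _) DE (e / (norm f + 1))) as [d [Hd H]].
{ apply Rdiv_lt_0_compat; lra. }
exists d; split; auto; intros y Hy.
specialize (H (Rabs (y - r))); rewrite Rminus_0_r, Rabs_Rabsolu in H; specialize (H Hy).
specialize (Rem (y - r)); replace (r + (y - r)) with y in Rem by ring.
apply Rle_trans with (1 := Rem).
change (Rabs (exp ((a + Rabs (y - r)) * M) - exp ((a + 0) * M)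
   - Rabs (y - r) * (M * exp (a * M))) <= e / (norm f + 1) * Rabs (y - r)) in H.
rewrite Rplus_0_r in H; set (X := exp _ - _ - _) in *.
apply Rle_trans with ((norm f + 1) * Rabs X).
- pose proof (Rle_abs X); pose proof (Rabs_pos X); nra.
- replace (e * Rabs (y - r)) with ((norm f + 1) * (e / (norm f + 1) * Rabs (y - r))) by (field; lra).
  apply Rmult_le_compat_l; lra.
Qed.

(* The difference of two solutions solves the same linear equation, which
   conserves the norm; all algebraic properties of [Th] follow from this. *)
Lemma Th_unique {h : posreal} (y : R -> L2 h) :
  (forall t, is_derive y t (iLap (y t))) -> forall t, y t = Th t (y 0).
Proof.
intros Hy t.
assert (N : norm (minus (y t) (Th t (y 0))) = norm (minus (y 0) (Th 0 (y 0)))).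
{ apply (norm_constant (fun t => minus (y t) (Th t (y 0)))
    (fun t => iLap (minus (y t) (Th t (y 0))))).
  - intros s; rewrite iLap_minus.
    apply (is_derive_minus (V := L2_NormedModule h)); [apply Hy|apply is_derive_Th].
  - intros s; apply ip_iLap_diag. }
rewrite Th_0 in N.
apply (ndist_eq_0 (V := L2_NormedModule h)).
etransitivity; [exact N|].
apply (ndist_refl (V := L2_NormedModule h)).
Qed.

Lemma norm_Th {h : posreal} (t : R) (f : L2 h) : norm (Th t f) = norm f.
Proof.
rewrite (norm_constant (fun t => Th t f) (fun t => iLap (Th t f))).
- now rewrite Th_0.
- intros s; apply is_derive_Th.
- intros s; apply ip_iLap_diag.
Qed.

Lemma Th_plus {h : posreal} (t : R) (f g : L2 h) : Th t (plus f g) = plus (Th t f) (Th t g).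
Proof.
symmetry; rewrite (Th_unique (fun t => plus (Th t f) (Th t g))).
- now rewrite !Th_0.
- intros s; rewrite iLap_plus; apply (is_derive_plus (V := L2_NormedModule h)); apply is_derive_Th.
Qed.

Lemma Th_cscal {h : posreal} (t : R) (c : C) (f : L2 h) : Th t (L2_cscal c f) = L2_cscal c (Th t f).
Proof.
symmetry; rewrite (Th_unique (fun t => L2_cscal c (Th t f))).
- now rewrite !Th_0.
- intros s; replace (iLap (L2_cscal c (Th s f))) with (L2_cscal c (iLap (Th s f))).
  + apply (is_linear_is_derive (V := L2_NormedModule h) (W := L2_NormedModule h)).
    * apply is_linear_cscal.
    * apply is_derive_Th.
  + unfold iLap; rewrite Lap_cscal; l2ring.
Qed.

Lemma Th_scal {h : posreal} (t a : R) (f : L2 h) : Th t (scal a f) = scal a (Th t f).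
Proof. apply Th_cscal. Qed.

Lemma Th_minus {h : posreal} (t : R) (f g : L2 h) : Th t (minus f g) = minus (Th t f) (Th t g).
Proof.
replace (minus f g) with (plus f (scal (-1) g)) by l2ring.
rewrite Th_plus, Th_scal; l2ring.
Qed.

Lemma Th_add {h : posreal} (t s : R) (f : L2 h) : Th (t + s) f = Th t (Th s f).
Proof.
rewrite (Th_unique (fun t => Th (t + s) f)).
- now rewrite Rplus_0_l.
- intros x; replace (iLap (Th (x + s) f)) with (scal 1 (iLap (Th (x + s) f))) by l2ring.
  apply (is_derive_comp (V := L2_NormedModule h) (fun r => Th r f) (fun t => t + s)).
  + apply is_derive_Th.
  + auto_derive; auto.
Qed.

Lemma Th_iLap {h : posreal} (t : R) (f : L2 h) : Th t (iLap f) = iLap (Th t f).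
Proof.
symmetry; rewrite (Th_unique (fun t => iLap (Th t f))).
- now rewrite Th_0.
- intros s; apply (is_linear_is_derive (V := L2_NormedModule h) (W := L2_NormedModule h)).
  + apply is_linear_iLap.
  + apply is_derive_Th.
Qed.

Lemma Th_opp_l {h : posreal} (t : R) (f : L2 h) : Th (- t) (Th t f) = f.
Proof. rewrite <- Th_add, Rplus_opp_l; apply Th_0. Qed.

Lemma Th_opp_r {h : posreal} (t : R) (f : L2 h) : Th t (Th (- t) f) = f.
Proof. rewrite <- Th_add, Rplus_opp_r; apply Th_0. Qed.

Lemma is_linear_Th {h : posreal} (t : R) :
  is_linear (U := L2_NormedModule h) (V := L2_NormedModule h) (Th t).
Proof.
apply Build_is_linear.
- apply Th_plus.
- intros k x; apply Th_scal.
- exists 1; split; [lra|]; intros x; rewrite Rmult_1_l; right; apply norm_Th.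
Qed.

(** Polarisation of norm conservation. *)
Lemma ip_Th {h : posreal} (t : R) (f g : L2 h) : ip (Th t f) (Th t g) = ip f g.
Proof.
pose proof (ip_diag (Th t (plus f g))) as E1; pose proof (ip_diag (plus f g)) as E2.
rewrite norm_Th, <- E2, Th_plus, !ip_plus_l, !ip_plus_r in E1.
rewrite !ip_diag, !norm_Th, (ip_sym (Th t g)), (ip_sym g) in E1; lra.
Qed.

Lemma ip_Th_opp {h : posreal} (t : R) (f g : L2 h) : ip (Th (- t) f) g = ip f (Th t g).
Proof. now rewrite <- (ip_Th t), Th_opp_r. Qed.

Lemma Th_inv_eq {h : posreal} (t : R) (f : L2 h) : Th_inv t f = Th (- t) f.
Proof.
apply (iota_unique (V := L2_CompleteNormedModule h)).
- intros g Hg; now rewrite <- Hg, Th_opp_l.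
- apply Th_opp_r.
Qed.

(** * The averaged nonlinearity *)

Lemma Rpow_pos (x y : R) : 0 < x -> Rpow x y = Rpower x y.
Proof. intros Hx; unfold Rpow; destruct (Req_EM_T x 0); [lra|reflexivity]. Qed.

Lemma Rpow_0 (y : R) : Rpow 0 y = 0.
Proof. unfold Rpow; destruct (Req_EM_T 0 0); [reflexivity|lra]. Qed.

Lemma Rpow_plus_2 (x q : R) : 0 <= x -> Rpow x (q + 2) = Rpow x q * (x * x).
Proof.
intros Hx; destruct (Req_EM_T x 0) as [->|H]; [rewrite !Rpow_0; ring|].
rewrite <- (Rpow_2 x Hx), !Rpow_pos by lra; apply Rpower_plus.
Qed.

Lemma Rpow_inv (x q : R) : 0 < q -> 0 <= x -> Rpow (Rpow x (/ q)) q = x.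
Proof.
intros Hq Hx; destruct (Req_EM_T x 0) as [->|H]; [now rewrite !Rpow_0|].
rewrite (Rpow_pos x) by lra; rewrite Rpow_pos by apply exp_pos.
rewrite Rpower_mult, Rinv_l by lra; apply Rpower_1; lra.
Qed.

Lemma is_derive_Rpower (y x : R) : 0 < x -> is_derive (fun x => Rpower x y) x (y * Rpower x (y - 1)).
Proof. intros Hx; apply is_derive_Reals, derivable_pt_lim_power, Hx. Qed.

Lemma Rpower_MVT (y a b : R) : 0 < a -> 0 < b ->
  exists c, Rmin a b <= c <= Rmax a b /\
    Rpower b y - Rpower a y = y * Rpower c (y - 1) * (b - a).
Proof.
intros Ha Hb; assert (Hm : 0 < Rmin a b) by now apply Rmin_pos.
apply (MVT_gen (fun x => Rpower x y) a b (fun x => y * Rpower x (y - 1))).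
- intros x Hx; apply is_derive_Rpower; lra.
- intros x Hx; apply continuity_pt_filterlim.
  apply (is_derive_continuous (fun x => Rpower x y) x (y * Rpower x (y - 1))).
  apply is_derive_Rpower; lra.
Qed.

(** For q < 1 the derivative of x^q blows up at 0, and the factor b compensates: at the mean value
    point c in [b, a], c^(q-1) b <= c^q <= a^q. *)
Lemma Rpow_diff_mul_le (q a b : R) : 0 < q -> 0 <= b <= a ->
  0 <= (Rpow a q - Rpow b q) * b <= q * Rpow a q * (a - b).
Proof.
intros Hq [Hb Hab].
assert (H0 : 0 <= Rpow a q - Rpow b q) by (pose proof (Rpow_le b a q ltac:(lra) ltac:(lra)); lra).
split; [now apply Rmult_le_pos|].
pose proof (Rpow_ge0 a q) as Pa.
destruct (Req_EM_T b 0) as [->|Hb0]; [rewrite Rmult_0_r; repeat apply Rmult_le_pos; lra|].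
destruct (Rpower_MVT q b a) as [c [Hc E]]; [lra|lra|].
rewrite Rmin_left, Rmax_right in Hc by lra.
rewrite !Rpow_pos in * by lra; rewrite E.
replace (Rpower a q) with (Rpower a (q - 1) * a).
2: { rewrite <- (Rpower_1 a) at 2 by lra; rewrite <- Rpower_plus; f_equal; ring. }
assert (Hca : Rpower c (q - 1) * c <= Rpower a (q - 1) * a).
{ rewrite <- (Rpower_1 c) at 2 by lra; rewrite <- (Rpower_1 a) at 2 by lra.
  rewrite <- !Rpower_plus; apply Rle_Rpower_l; lra. }
assert (0 < Rpower c (q - 1)) by apply exp_pos.
assert (Rpower c (q - 1) * b <= Rpower c (q - 1) * c) by (apply Rmult_le_compat_l; lra).
replace (q * Rpower c (q - 1) * (a - b) * b) with (q * (a - b) * (Rpower c (q - 1) * b)) by ring.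
replace (q * (Rpower a (q - 1) * a) * (a - b)) with (q * (a - b) * (Rpower a (q - 1) * a)) by ring.
apply Rmult_le_compat_l; [apply Rmult_le_pos|]; lra.
Qed.

Definition pow_nlC (p : R) (z : C) : C := (Rpow (Cmod z) (p - 1) * z)%C.

Lemma pow_nlC_lipschitz (p M : R) (z w : C) : 1 < p -> Cmod z <= M -> Cmod w <= M ->
  Cmod (pow_nlC p z - pow_nlC p w) <= p * Rpow M (p - 1) * Cmod (z - w).
Proof.
intros Hp.
assert (P : forall z w, Cmod w <= Cmod z -> Cmod z <= M ->
  Cmod (pow_nlC p z - pow_nlC p w) <= p * Rpow M (p - 1) * Cmod (z - w)).
{ clear z w; intros z w H Hz; unfold pow_nlC.
  pose proof (Cmod_ge_0 w) as H0.
  pose proof (Rpow_diff_mul_le (p - 1) (Cmod z) (Cmod w) ltac:(lra) ltac:(lra)) as Q.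
  set (a := Rpow (Cmod z) (p - 1)) in *; set (b := Rpow (Cmod w) (p - 1)) in *.
  assert (Ha : 0 <= a) by apply Rpow_ge0.
  (* With |w| <= |z| the first part costs a and the second (p - 1) a, which gives the factor p. *)
  replace (a * z - b * w)%C with (a * (z - w) + (a - b)%R * w)%C by (rewrite RtoC_minus; ring).
  eapply Rle_trans; [apply Cmod_triangle|]; rewrite !Cmod_mult, !Cmod_R.
  assert (Hab : b <= a) by (apply Rpow_le; lra).
  rewrite (Rabs_pos_eq a), (Rabs_pos_eq (a - b)) by lra.
  assert (T : Cmod z - Cmod w <= Cmod (z - w)).
  { pose proof (Cmod_triangle (z - w) w) as T; replace (z - w + w)%C with z in T by ring; lra. }
  assert (HaM : a <= Rpow M (p - 1)) by (apply Rpow_le; lra).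
  assert ((p - 1) * a * (Cmod z - Cmod w) <= (p - 1) * a * Cmod (z - w)).
  { apply Rmult_le_compat_l; [apply Rmult_le_pos|]; lra. }
  assert (p * a * Cmod (z - w) <= p * Rpow M (p - 1) * Cmod (z - w)).
  { apply Rmult_le_compat_r; [apply Cmod_ge_0|apply Rmult_le_compat_l; lra]. }
  lra. }
intros Hz Hw; destruct (Rle_dec (Cmod w) (Cmod z)); [now apply P|].
rewrite <- (Cmod_opp (pow_nlC p z - _)), <- (Cmod_opp (z - w)).
replace (- (pow_nlC p z - pow_nlC p w))%C with (pow_nlC p w - pow_nlC p z)%C by ring.
replace (- (z - w))%C with (w - z)%C by ring.
apply P; lra.
Qed.

Lemma Rpow_mul_lipschitz (q M a b : R) : 0 < q -> 0 <= a <= M -> 0 <= b <= M ->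
  Rabs (Rpow a q * a - Rpow b q * b) <= (q + 1) * Rpow M q * Rabs (a - b).
Proof.
intros Hq [Ha HaM] [Hb HbM].
pose proof (pow_nlC_lipschitz (q + 1) M (RtoC a) (RtoC b)) as H; unfold pow_nlC in H.
replace (q + 1 - 1) with q in H by ring.
rewrite <- !RtoC_mult, <- !RtoC_minus, !Cmod_R, !(Rabs_pos_eq a), !(Rabs_pos_eq b) in H by lra.
apply H; lra.
Qed.

(* Taylor expansion of [x^(p+1)] in the variable [x^2], because
   |w|^2 - |z|^2 = 2 Re (conj z (w - z)) + |w - z|^2 for complex z, w. *)
Lemma Rpow_taylor (p M a b : R) : 1 < p -> 0 <= a <= M -> 0 <= b <= M ->
  Rabs (Rpow a (p + 1) - Rpow b (p + 1) - (p + 1) / 2 * Rpow b (p - 1) * (a * a - b * b))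
  <= (p + 1) ^ 2 * Rpow M (p - 1) * ((a - b) * (a - b)).
Proof.
intros Hp [Ha HaM] [Hb HbM].
assert (E : forall x, 0 <= x -> Rpow x (p + 1) = Rpow x (p - 1) * (x * x)).
{ intros x Hx; rewrite <- Rpow_plus_2 by auto; f_equal; ring. }
assert (Mon : forall x, 0 <= x <= M -> 0 <= Rpow x (p - 1) <= Rpow M (p - 1)).
{ intros x Hx; split; [apply Rpow_ge0|apply Rpow_le; lra]. }
pose proof (Mon a ltac:(lra)) as Ma; pose proof (Mon b ltac:(lra)) as Mb.
assert (K1 : 4 <= (p + 1) ^ 2) by nra.
(* The mean value theorem for [Rpower] needs positive arguments. If one of a, b vanishes, the
   remainder is a single power with coefficient 1 or (p - 1) / 2, both below (p + 1)^2. *)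
destruct (Req_EM_T b 0) as [->|Hb0].
{ rewrite !E, Rpow_0 by lra.
  replace (Rpow a (p - 1) * (a * a) - 0 * (0 * 0) - (p + 1) / 2 * 0 * (a * a - 0 * 0))
    with (Rpow a (p - 1) * (a * a)) by ring.
  replace ((a - 0) * (a - 0)) with (a * a) by ring.
  rewrite Rabs_pos_eq by (apply Rmult_le_pos; [lra|apply Rle_0_sqr]).
  apply Rmult_le_compat_r; [apply Rle_0_sqr|].
  rewrite <- (Rmult_1_l (Rpow a _)); apply Rmult_le_compat; lra. }
destruct (Req_EM_T a 0) as [->|Ha0].
{ rewrite !E, Rpow_0 by lra.
  replace (0 * (0 * 0) - Rpow b (p - 1) * (b * b) - (p + 1) / 2 * Rpow b (p - 1) * (0 * 0 - b * b))
    with ((p - 1) / 2 * Rpow b (p - 1) * (b * b)) by field.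
  replace ((0 - b) * (0 - b)) with (b * b) by ring.
  rewrite Rabs_pos_eq by (repeat apply Rmult_le_pos; lra).
  apply Rmult_le_compat_r; [apply Rle_0_sqr|].
  apply Rmult_le_compat; try lra; nra. }
destruct (Rpower_MVT (p + 1) b a) as [c [Hc Ec]]; [lra|lra|].
pose proof (Rmin_pos b a ltac:(lra) ltac:(lra)) as Hm.
pose proof (Rmax_lub b a M HbM HaM) as HM.
rewrite <- !Rpow_pos in Ec by lra; rewrite Ec.
assert (Hcb : Rabs (c - b) <= Rabs (a - b)).
{ revert Hc; unfold Rmin, Rmax; destruct (Rle_dec b a); intros Hc;
    unfold Rabs; repeat destruct Rcase_abs; lra. }
replace (Rpow c (p + 1 - 1)) with (Rpow c (p - 1) * c).
2: { rewrite !Rpow_pos by lra; rewrite <- (Rpower_1 c) at 2 by lra.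
  rewrite <- Rpower_plus; f_equal; ring. }
pose proof (Rpow_mul_lipschitz (p - 1) M c b ltac:(lra) ltac:(lra) ltac:(lra)) as L.
(* As a^2 - b^2 = (a - b)(2b + (a - b)), the remainder is (p + 1)(a - b) times X - B b - (B / 2)(a -
   b). The difference X - B b costs a factor p by the Lipschitz bound for x^p, the last term at most
   1. *)
set (X := Rpow c (p - 1) * c) in *; set (B := Rpow b (p - 1)) in *.
replace ((p + 1) * X * (a - b) - (p + 1) / 2 * B * (a * a - b * b))
  with ((p + 1) * (a - b) * ((X - B * b) - B / 2 * (a - b))) by field.
rewrite !Rabs_mult, (Rabs_pos_eq (p + 1)) by lra.
replace ((a - b) * (a - b)) with (Rabs (a - b) * Rabs (a - b))
  by (rewrite <- Rabs_mult; apply Rabs_pos_eq, Rle_0_sqr).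
set (D := Rabs (a - b)) in *; assert (HD : 0 <= D) by apply Rabs_pos.
assert (Rabs (X - B * b - B / 2 * (a - b)) <= (p + 1) * Rpow M (p - 1) * D).
{ unfold Rminus at 1; eapply Rle_trans; [apply Rabs_triang|].
  rewrite Rabs_Ropp, Rabs_mult, (Rabs_pos_eq (B / 2)) by lra; fold D.
  assert (B / 2 * D <= Rpow M (p - 1) * D) by (apply Rmult_le_compat_r; lra).
  assert ((p - 1 + 1) * Rpow M (p - 1) * Rabs (c - b) <= p * Rpow M (p - 1) * D).
  { replace (p - 1 + 1) with p by ring; apply Rmult_le_compat_l; [apply Rmult_le_pos|]; lra. }
  lra. }
replace ((p + 1) ^ 2 * Rpow M (p - 1) * (D * D))
  with ((p + 1) * D * ((p + 1) * Rpow M (p - 1) * D)) by ring.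
apply Rmult_le_compat_l; [apply Rmult_le_pos|]; lra.
Qed.

(** The constant is (p + 1)^2 + (p + 1): the first summand is the real remainder, as |w| and |z|
    differ by at most |w - z|, and the second absorbs the term |w - z|^2 in the expansion of |w|^2 -
    |z|^2. *)
Lemma Cmod_pow_taylor (p M : R) (z w : C) : 1 < p -> Cmod z <= M -> Cmod w <= M ->
  Rabs (Rpow (Cmod w) (p + 1) - Rpow (Cmod z) (p + 1) - (p + 1) * cdot (pow_nlC p z) (w - z))
  <= (p + 1) * (p + 2) * Rpow M (p - 1) * (Cmod (w - z) * Cmod (w - z)).
Proof.
intros Hp Hz Hw.
pose proof (Cmod_ge_0 z) as Pz; pose proof (Cmod_ge_0 w) as Pw.
pose proof (Rpow_taylor p M (Cmod w) (Cmod z) Hp ltac:(lra) ltac:(lra)) as T.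
assert (E : cdot (pow_nlC p z) (w - z) = Rpow (Cmod z) (p - 1) * cdot z (w - z)).
{ unfold pow_nlC, cdot; simpl; ring. }
assert (E2 : Cmod w * Cmod w - Cmod z * Cmod z
             = 2 * cdot z (w - z) + Cmod (w - z) * Cmod (w - z)).
{ rewrite <- !cdot_diag; unfold cdot; simpl; ring. }
rewrite E2 in T; rewrite E.
assert (Hb : 0 <= Rpow (Cmod z) (p - 1) <= Rpow M (p - 1)).
{ split; [apply Rpow_ge0|apply Rpow_le; lra]. }
set (B := Rpow (Cmod z) (p - 1)) in *; set (D := Cmod (w - z)) in *.
assert (HD0 : 0 <= D) by apply Cmod_ge_0.
assert (HD : 0 <= D * D) by apply Rle_0_sqr.
assert (Hwz : (Cmod w - Cmod z) * (Cmod w - Cmod z) <= D * D).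
{ assert (Rabs (Cmod w - Cmod z) <= D).
  { apply Rabs_le; unfold D.
    pose proof (Cmod_triangle (w - z) z) as T1; replace (w - z + z)%C with w in T1 by ring.
    pose proof (Cmod_triangle (- (w - z)) w) as T2; replace (- (w - z) + w)%C with z in T2 by ring.
    rewrite Cmod_opp in T2; lra. }
  rewrite <- (Rabs_pos_eq ((Cmod w - Cmod z) * _)) by apply Rle_0_sqr.
  rewrite Rabs_mult; apply Rmult_le_compat; auto using Rabs_pos. }
replace (Rpow (Cmod w) (p + 1) - Rpow (Cmod z) (p + 1) - (p + 1) * (B * cdot z (w - z)))
  with ((Rpow (Cmod w) (p + 1) - Rpow (Cmod z) (p + 1)
         - (p + 1) / 2 * B * (2 * cdot z (w - z) + D * D)) + (p + 1) / 2 * B * (D * D)) by field.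
eapply Rle_trans; [apply Rabs_triang|].
rewrite (Rabs_pos_eq ((p + 1) / 2 * B * (D * D))) by (repeat apply Rmult_le_pos; lra).
assert ((p + 1) / 2 * B * (D * D) <= (p + 1) * Rpow M (p - 1) * (D * D)).
{ apply Rmult_le_compat_r; auto; apply Rmult_le_compat; lra. }
assert ((p + 1) ^ 2 * Rpow M (p - 1) * ((Cmod w - Cmod z) * (Cmod w - Cmod z))
  <= (p + 1) ^ 2 * Rpow M (p - 1) * (D * D)).
{ apply Rmult_le_compat_l; auto; apply Rmult_le_pos; [apply pow2_ge_0|lra]. }
lra.
Qed.

(** * Pointwise estimates lifted to L^2_h *)

Lemma L2_coord_le {h : posreal} (f : L2 h) (R0 : R) (m : Z) :
  norm f <= R0 -> Cmod (f m) <= R0 / sqrt h.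
Proof.
intros H; eapply Rle_trans; [apply (L2_norm_coord h)|].
unfold Rdiv; apply Rmult_le_compat_r; [|exact H].
left; apply Rinv_0_lt_compat, sqrt_lt_R0, cond_pos.
Qed.

Lemma L2norm_le_pointwise {h : posreal} (c : R) (f g : L2 h) : 0 <= c ->
  (forall m, Cmod (g m) <= c * Cmod (f m)) -> norm g <= c * norm f.
Proof.
intros Hc H; apply (L2_norm_le h); intros N.
eapply Rle_trans; [now apply (pnorm_le h c f g)|].
apply Rmult_le_compat_l; auto; apply (L2_pnorm_le h).
Qed.

(* R0 / sqrt h bounds sup |f| on the ball of radius R0 of L^2_h. *)
Definition nl_lip (h : posreal) (p R0 : R) : R := p * Rpow (R0 / sqrt h) (p - 1).

Lemma nl_lip_ge_0 (h : posreal) (p R0 : R) : 1 < p -> 0 <= nl_lip h p R0.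
Proof. intros Hp; apply Rmult_le_pos; [lra|apply Rpow_ge0]. Qed.

Lemma pow_nl_lipschitz {h : posreal} {p : R} (hp : 1 < p) (R0 : R) (f g : L2 h) :
  norm f <= R0 -> norm g <= R0 ->
  norm (minus (pow_nl hp f) (pow_nl hp g)) <= nl_lip h p R0 * norm (minus f g).
Proof.
intros Hf Hg; apply L2norm_le_pointwise; [now apply nl_lip_ge_0|]; intros m.
replace (minus (pow_nl hp f) (pow_nl hp g) m) with (pow_nlC p (f m) - pow_nlC p (g m))%C
  by (unfold minus; simpl; unfold pow_fun, pow_nlC; ring).
replace (minus f g m) with (f m - g m)%C by (unfold minus; simpl; ring).
apply pow_nlC_lipschitz; auto using L2_coord_le.
Qed.

Definition Lq_pow {h : posreal} (p : R) (f : L2 h) : R := Rpow (Lq_norm h (p + 1) f) (p + 1).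

(** L^2_h embeds into the bounded sequences, so |f|^(p+1) is at most a constant times |f|^2. *)
Lemma Zsummable_Rpow {h : posreal} (p : R) (f : L2 h) : 1 < p ->
  Zsummable (fun m => Rpow (Cmod (f m)) (p + 1)).
Proof.
intros Hp; apply Zsummable_le with
  (fun m => Rpow (norm f / sqrt h) (p - 1) * (Cmod (f m) * Cmod (f m))).
- intros m; rewrite Rabs_pos_eq by apply Rpow_ge0.
  replace (p + 1) with (p - 1 + 2) by ring; rewrite Rpow_plus_2 by apply Cmod_ge_0.
  apply Rmult_le_compat_r; [apply Rle_0_sqr|].
  apply Rpow_le; [split; [apply Cmod_ge_0|apply L2_coord_le, Rle_refl]|lra].
- apply Zsummable_scal, Zsummable_sq, L2_in.
Qed.

Lemma Lq_pow_eq {h : posreal} (p : R) (f : L2 h) : 1 < p ->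
  Lq_pow p f = h * Zsum (fun m => Rpow (Cmod (f m)) (p + 1)).
Proof.
intros Hp; apply Rpow_inv; [lra|].
apply Rmult_le_pos; [left; apply cond_pos|].
apply Zsum_ge_0; [intros m; apply Rpow_ge0|now apply Zsummable_Rpow].
Qed.

Definition taylor_cst (h : posreal) (p R0 : R) : R := (p + 1) * (p + 2) * Rpow (R0 / sqrt h) (p - 1).

Lemma Lq_pow_taylor {h : posreal} {p : R} (hp : 1 < p) (R0 : R) (z w : L2 h) :
  norm z <= R0 -> norm w <= R0 ->
  Rabs (Lq_pow p w - Lq_pow p z - (p + 1) * ip (pow_nl hp z) (minus w z))
  <= taylor_cst h p R0 * norm (minus w z) ^ 2.
Proof.
intros Hz Hw; pose proof (cond_pos h) as Hh.
(* The three sums are merged into one, so that the pointwise expansion can be summed. *)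
set (F := fun m => Rpow (Cmod (w m)) (p + 1) + ((-1) * Rpow (Cmod (z m)) (p + 1)
   + (- (p + 1)) * cdot (pow_nl hp z m) (minus w z m))).
assert (Sw := Zsummable_Rpow p w hp); assert (Sz := Zsummable_Rpow p z hp).
assert (Sc := Zsummable_cdot _ _ (L2_in _ (pow_nl hp z)) (L2_in _ (minus w z))).
replace (Lq_pow p w - Lq_pow p z - (p + 1) * ip (pow_nl hp z) (minus w z)) with (h * Zsum F).
2: { rewrite !Lq_pow_eq by auto; unfold F, ip.
  rewrite !Zsum_plus, !Zsum_scal; auto using Zsummable_scal.
  - ring.
  - apply Zsummable_plus; auto using Zsummable_scal. }
rewrite <- ip_diag; unfold ip; rewrite Rabs_mult, (Rabs_pos_eq h) by lra.
replace (taylor_cst h p R0 * (h * Zsum (fun m => cdot (minus w z m) (minus w z m))))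
  with (h * Zsum (fun m => taylor_cst h p R0 * cdot (minus w z m) (minus w z m)))
  by (rewrite Zsum_scal; ring).
apply Rmult_le_compat_l; [lra|].
apply Rabs_Zsum_le.
- intros m; unfold F; rewrite cdot_diag.
  replace (minus w z m) with (w m - z m)%C by (unfold minus; simpl; ring).
  replace (Rpow (Cmod (w m)) (p + 1) + (-1 * Rpow (Cmod (z m)) (p + 1) +
    - (p + 1) * cdot (pow_nl hp z m) (w m - z m)))
    with (Rpow (Cmod (w m)) (p + 1) - Rpow (Cmod (z m)) (p + 1)
      - (p + 1) * cdot (pow_nlC p (z m)) (w m - z m))
    by (change (pow_nlC p (z m)) with (pow_nl hp z m); ring).
  apply Cmod_pow_taylor; auto using L2_coord_le.
- apply Zsummable_scal, Zsummable_cdot; apply L2_in.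
Qed.

Lemma ip_pow_nl_Ci {h : posreal} {p : R} (hp : 1 < p) (f : L2 h) :
  ip (pow_nl hp f) (L2_cscal Ci f) = 0.
Proof.
unfold ip; replace (Zsum _) with (0 * Zsum (fun _ => 0)); [ring|].
rewrite <- Zsum_scal; f_equal; apply functional_extensionality; intros m.
unfold cdot; simpl; unfold pow_fun; simpl; ring.
Qed.

Lemma L2_continuous_eps {h : posreal} (f : R -> L2 h) (x : R) :
  continuous f x <-> forall eps, 0 < eps -> exists d, 0 < d /\
    forall y, Rabs (y - x) < d -> norm (minus (f y) (f x)) < eps.
Proof. apply (continuous_eps (V := L2_NormedModule h)). Qed.

Lemma L2_is_derive_eps {h : posreal} (f : R -> L2 h) (x : R) (l : L2 h) :
  is_derive f x l <-> forall eps, 0 < eps -> exists d, 0 < d /\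
    forall y, Rabs (y - x) < d ->
    norm (minus (minus (f y) (f x)) (scal (y - x) l)) <= eps * Rabs (y - x).
Proof. apply (is_derive_eps (V := L2_NormedModule h)). Qed.

Lemma continuous_Th {h : posreal} (c : R) (v : R -> L2 h) (t : R) :
  continuous v t -> continuous (fun s => Th (c * s) (v s)) t.
Proof.
intros Hv; apply L2_continuous_eps; intros e He.
assert (Hc : continuous (fun s => Th (c * s) (v t)) t).
{ apply (is_derive_continuous (V := L2_NormedModule h) _ _ (scal c (iLap (Th (c * t) (v t))))).
  apply (is_derive_comp (V := L2_NormedModule h) (fun r => Th r (v t)) (fun s => c * s)).
  - apply is_derive_Th.
  - auto_derive; auto; ring. }
destruct (proj1 (L2_continuous_eps _ _) Hv (e / 2)) as [d1 [Hd1 H1]]; [lra|].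
destruct (proj1 (L2_continuous_eps _ _) Hc (e / 2)) as [d2 [Hd2 H2]]; [lra|].
exists (Rmin d1 d2); split; [now apply Rmin_pos|]; intros y Hy.
specialize (H1 y (Rlt_le_trans _ _ _ Hy (Rmin_l _ _))).
specialize (H2 y (Rlt_le_trans _ _ _ Hy (Rmin_r _ _))).
rewrite <- (norm_Th (c * y)), Th_minus in H1.
eapply Rle_lt_trans; [apply (ndist_triangle (V := L2_NormedModule h) (Th (c * y) (v t)))|].
replace e with (e / 2 + e / 2) by field; now apply Rplus_lt_compat.
Qed.

Lemma is_derive_Th_comp {h : posreal} (c : R) (v : R -> L2 h) (t : R) (l : L2 h) :
  is_derive v t l ->
  is_derive (fun s => Th (c * s) (v s)) t (plus (Th (c * t) l) (scal c (iLap (Th (c * t) (v t))))).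
Proof.
intros Hv; apply L2_is_derive_eps; intros e He.
assert (Hd : is_derive (fun s => Th (c * s) (v t)) t (scal c (iLap (Th (c * t) (v t))))).
{ apply (is_derive_comp (V := L2_NormedModule h) (fun r => Th r (v t)) (fun s => c * s)).
  - apply is_derive_Th.
  - auto_derive; auto; ring. }
assert (Hc : continuous (fun s => Th (c * s) l) t).
{ apply (continuous_Th c (fun _ => l)), continuous_const. }
destruct (proj1 (L2_is_derive_eps _ _ _) Hv (e / 3)) as [d1 [Hd1 H1]]; [lra|].
destruct (proj1 (L2_is_derive_eps _ _ _) Hd (e / 3)) as [d2 [Hd2 H2]]; [lra|].
destruct (proj1 (L2_continuous_eps _ _) Hc (e / 3)) as [d3 [Hd3 H3]]; [lra|].
exists (Rmin d1 (Rmin d2 d3)); split; [now repeat apply Rmin_pos|]; intros y Hy.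
pose proof (Rmin_l d1 (Rmin d2 d3)); pose proof (Rmin_r d1 (Rmin d2 d3)).
pose proof (Rmin_l d2 d3); pose proof (Rmin_r d2 d3).
specialize (H1 y ltac:(lra)); specialize (H2 y ltac:(lra)); specialize (H3 y ltac:(lra)).
rewrite <- (norm_Th (c * y)) in H1.
set (X1 := Th (c * y) (minus (minus (v y) (v t)) (scal (y - t) l))) in *.
set (X2 := minus (minus (Th (c * y) (v t)) (Th (c * t) (v t)))
  (scal (y - t) (scal c (iLap (Th (c * t) (v t)))))) in *.
set (X3 := minus (Th (c * y) l) (Th (c * t) l)) in *.
replace (minus (minus (Th (c * y) (v y)) (Th (c * t) (v t)))
  (scal (y - t) (plus (Th (c * t) l) (scal c (iLap (Th (c * t) (v t)))))))
  with (plus X1 (plus X2 (scal (y - t) X3))).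
2: { unfold X1, X2, X3; rewrite !Th_minus, Th_scal; l2ring. }
replace (e * Rabs (y - t))
  with (e / 3 * Rabs (y - t) + (e / 3 * Rabs (y - t) + Rabs (y - t) * (e / 3))) by field.
eapply Rle_trans; [apply L2norm_triangle|]; apply Rplus_le_compat; [exact H1|].
eapply Rle_trans; [apply L2norm_triangle|]; apply Rplus_le_compat; [exact H2|].
eapply Rle_trans; [apply L2norm_scal|].
apply Rmult_le_compat_l; [apply Rabs_pos|left; exact H3].
Qed.

Lemma continuous_Qav_integrand {h : posreal} {p : R} (hp : 1 < p) (f : L2 h) (t : R) :
  continuous (fun r => Th (- r) (pow_nl hp (Th r f))) t.
Proof.
apply (continuous_ext (fun r => Th (-1 * r) (pow_nl hp (Th r f)))).
{ intros r; f_equal; ring. }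
apply (continuous_Th (-1) (fun r => pow_nl hp (Th r f))).
(* The orbit of f stays on the sphere of radius norm f, so the Lipschitz constant of that ball
   serves for all r. *)
apply (continuous_of_lipschitz (V := L2_NormedModule h) (W := L2_NormedModule h)
  (nl_lip h p (norm f)) (fun r => Th r f)).
- intros s; apply pow_nl_lipschitz; rewrite norm_Th; apply Rle_refl.
- eapply (is_derive_continuous (V := L2_NormedModule h)), is_derive_Th.
Qed.

Lemma Qav_eq {h : posreal} {p : R} (hp : 1 < p) (f : L2 h) :
  Qav hp f = RInt (fun r => Th (- r) (pow_nl hp (Th r f))) 0 1.
Proof.
unfold Qav; f_equal; apply functional_extensionality; intros r; apply Th_inv_eq.
Qed.

Lemma Qav_lipschitz {h : posreal} {p : R} (hp : 1 < p) (R0 : R) (f g : L2 h) :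
  norm f <= R0 -> norm g <= R0 ->
  norm (minus (Qav hp f) (Qav hp g)) <= nl_lip h p R0 * norm (minus f g).
Proof.
intros Hf Hg; rewrite !Qav_eq.
set (F := fun f : L2 h => fun r => Th (- r) (pow_nl hp (Th r f))).
replace (nl_lip h p R0 * norm (minus f g)) with ((1 - 0) * (nl_lip h p R0 * norm (minus f g))) by ring.
apply (norm_RInt_le_const (V := L2_NormedModule h) (fun r => minus (F f r) (F g r)) 0 1); [lra| |].
- intros r _; unfold F; rewrite <- Th_minus, norm_Th, <- (norm_Th r (minus f g)), Th_minus.
  apply pow_nl_lipschitz; now rewrite norm_Th.
- apply (is_RInt_minus (V := L2_NormedModule h));
    apply (RInt_correct (V := L2_CompleteNormedModule h)),
      (ex_RInt_cont (V := L2_CompleteNormedModule h)); apply continuous_Qav_integrand.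
Qed.

Lemma ip_Qav {h : posreal} {p : R} (hp : 1 < p) (f g : L2 h) :
  ip (Qav hp f) g = RInt (fun r => ip (pow_nl hp (Th r f)) (Th r g)) 0 1.
Proof.
rewrite Qav_eq.
rewrite <- (RInt_linear (V := L2_CompleteNormedModule h) (W := R_CompleteNormedModule)
  (fun k => ip k g)); [|apply is_linear_ip|apply continuous_Qav_integrand].
apply RInt_ext; intros r _; apply ip_Th_opp.
Qed.

Lemma ip_Qav_Ci {h : posreal} {p : R} (hp : 1 < p) (f : L2 h) :
  ip (Qav hp f) (L2_cscal Ci f) = 0.
Proof.
rewrite ip_Qav, (RInt_ext _ (fun _ => 0)).
- rewrite RInt_const; apply Rmult_0_r.
- intros r _; rewrite Th_cscal; apply ip_pow_nl_Ci.
Qed.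

Definition potential {h : posreal} (p : R) (f : L2 h) : R := RInt (fun r => Lq_pow p (Th r f)) 0 1.

(** Continuity comes from differentiability by the chain rule; points within distance 1 of the orbit
    have norm at most norm f + 1. *)
Lemma continuous_Lq_pow_Th {h : posreal} {p : R} (hp : 1 < p) (f : L2 h) (t : R) :
  continuous (fun r => Lq_pow p (Th r f)) t.
Proof.
apply (is_derive_continuous (V := R_NormedModule) _ _
  (ip (scal (p + 1) (pow_nl hp (Th t f))) (iLap (Th t f)))).
apply (is_derive_chain (Lq_pow p) (fun r => Th r f) t (taylor_cst h p (norm f + 1))).
- intros w Hw; rewrite ip_scal_l; apply Lq_pow_taylor; rewrite ?norm_Th.
  + lra.
  + pose proof (L2norm_le_minus w (Th t f)) as T; rewrite norm_Th in T; lra.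
- apply is_derive_Th.
Qed.

(** The expansion at fixed r has a constant independent of r, since [Th r] preserves both the ball
    and the increment's norm, and is integrated over the unit interval. *)
Lemma potential_taylor {h : posreal} {p : R} (hp : 1 < p) (R0 : R) (z w : L2 h) :
  norm z <= R0 -> norm w <= R0 ->
  Rabs (potential p w - potential p z - (p + 1) * ip (Qav hp z) (minus w z))
  <= taylor_cst h p R0 * norm (minus w z) ^ 2.
Proof.
intros Hz Hw.
assert (Ci : forall t, continuous (fun r => ip (pow_nl hp (Th r z)) (Th r (minus w z))) t).
{ intros t; apply (continuous_ext (fun r => ip (Th (- r) (pow_nl hp (Th r z))) (minus w z))).
  - intros r; apply ip_Th_opp.
  - apply (continuous_comp (fun r => Th (- r) (pow_nl hp (Th r z))) (fun k => ip k (minus w z))).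
    + apply continuous_Qav_integrand.
    + apply (linear_cont (U := L2_NormedModule h) (V := R_NormedModule)), is_linear_ip. }
set (F := fun r => minus (minus (Lq_pow p (Th r w)) (Lq_pow p (Th r z)))
  (scal (p + 1) (ip (pow_nl hp (Th r z)) (Th r (minus w z))))).
assert (I : is_RInt F 0 1
  (minus (minus (potential p w) (potential p z)) (scal (p + 1) (ip (Qav hp z) (minus w z))))).
{ apply (is_RInt_minus (V := R_NormedModule)).
  - apply (is_RInt_minus (V := R_NormedModule));
      apply (RInt_correct (V := R_CompleteNormedModule)), (ex_RInt_cont (V := R_CompleteNormedModule));
      now apply continuous_Lq_pow_Th.
  - apply (is_RInt_scal (V := R_NormedModule)); rewrite ip_Qav.
    apply (RInt_correct (V := R_CompleteNormedModule)), (ex_RInt_cont (V := R_CompleteNormedModule)), Ci. }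
replace (taylor_cst h p R0 * norm (minus w z) ^ 2)
  with ((1 - 0) * (taylor_cst h p R0 * norm (minus w z) ^ 2)) by ring.
apply (norm_RInt_le_const (V := R_NormedModule) F 0 1 _ _ Rle_0_1) with (2 := I).
intros r _; rewrite <- (norm_Th r (minus w z)).
change (Rabs (Lq_pow p (Th r w) - Lq_pow p (Th r z)
  - (p + 1) * ip (pow_nl hp (Th r z)) (Th r (minus w z))) <=
  taylor_cst h p R0 * norm (Th r (minus w z)) ^ 2).
rewrite Th_minus; apply Lq_pow_taylor; now rewrite norm_Th.
Qed.

(** * The averaged equation *)

(** Bounding |y'| covers both directions of time: with c the sign of t, y(s) exp(-cKs) does not
    increase from 0 towards t. *)
Lemma gronwall (y dy : R -> R) (K : R) :
  (forall t, is_derive y t (dy t)) -> (forall t, Rabs (dy t) <= K * y t) ->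
  forall t, y t <= y 0 * exp (K * Rabs t).
Proof.
intros Hd HK t.
assert (P : forall c : R, Rabs c = 1 ->
  exists s, y t * exp (- (c * K * t)) - y 0 = (dy s - c * K * y s) * exp (- (c * K * s)) * t).
{ intros c Hc.
  set (z := fun s => y s * exp (- (c * K * s))).
  assert (Hz : forall s, is_derive z s ((dy s - c * K * y s) * exp (- (c * K * s)))).
  { intros s; unfold z.
    replace ((dy s - c * K * y s) * exp (- (c * K * s)))
      with (dy s * exp (- (c * K * s)) + y s * (- (c * K) * exp (- (c * K * s)))) by ring.
    apply (is_derive_mult y (fun s => exp (- (c * K * s)))); [apply Hd| |intros; apply Rmult_comm].
    auto_derive; auto; ring. }
  destruct (MVT_gen z 0 t _ (fun s _ => Hz s)) as [s [_ Hs]].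
  - intros x _; apply continuity_pt_filterlim, (is_derive_continuous z x _ (Hz x)).
  - exists s; unfold z in Hs; rewrite Rmult_0_r, Ropp_0, exp_0, Rmult_1_r, Rminus_0_r in Hs; exact Hs. }
assert (Q : forall c, Rabs t = c * t -> Rabs c = 1 -> (forall s, (dy s - c * K * y s) * t <= 0) ->
  y t <= y 0 * exp (K * Rabs t)).
{ intros c Hct Hc Hs; destruct (P c Hc) as [s Es].
  pose proof (exp_pos (- (c * K * s))) as E1; pose proof (exp_pos (K * Rabs t)) as E2.
  assert (H0 : y t * exp (- (c * K * t)) <= y 0).
  { specialize (Hs s).
    assert ((dy s - c * K * y s) * exp (- (c * K * s)) * t <= 0) by nra; lra. }
  replace (c * K * t) with (K * Rabs t) in H0 by (rewrite Hct; ring).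
  apply Rmult_le_compat_r with (r := exp (K * Rabs t)) in H0; [|lra].
  rewrite Rmult_assoc, <- exp_plus, Rplus_opp_l, exp_0, Rmult_1_r in H0; exact H0. }
destruct (Rle_dec 0 t) as [Ht|Ht].
- apply (Q 1); [rewrite Rabs_pos_eq; lra|apply Rabs_R1|].
  intros s; pose proof (Rle_abs (dy s)); specialize (HK s).
  assert (dy s - 1 * K * y s <= 0) by lra; nra.
- apply (Q (-1)); [rewrite Rabs_left; lra|rewrite Rabs_left; lra|].
  intros s; pose proof (Rle_abs (- dy s)) as A; rewrite Rabs_Ropp in A; specialize (HK s).
  assert (0 <= dy s - -1 * K * y s) by lra; nra.
Qed.

(** For R0 > 0 the scale has a denominator of at least R0, so f = 0 needs no separate case. *)
Definition trunc {h : posreal} (R0 : R) (f : L2 h) : L2 h := scal (R0 / Rmax R0 (norm f)) f.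

Lemma norm_trunc_le {h : posreal} (R0 : R) (f : L2 h) : 0 < R0 -> norm (trunc R0 f) <= R0.
Proof.
intros HR; unfold trunc; pose proof (Rmax_l R0 (norm f)); pose proof (Rmax_r R0 (norm f)).
eapply Rle_trans; [apply L2norm_scal|].
rewrite Rabs_pos_eq by (apply Rdiv_le_0_compat; lra).
apply Rmult_le_reg_r with (Rmax R0 (norm f)); [lra|].
replace (R0 / Rmax R0 (norm f) * norm f * Rmax R0 (norm f)) with (R0 * norm f) by (field; lra).
apply Rmult_le_compat_l; lra.
Qed.

Lemma trunc_id {h : posreal} (R0 : R) (f : L2 h) : 0 < R0 -> norm f <= R0 -> trunc R0 f = f.
Proof.
intros HR Hf; unfold trunc; rewrite Rmax_left by auto.
replace (R0 / R0) with 1 by (field; lra); apply (scal_one (V := L2_ModuleSpace h)).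
Qed.

Lemma trunc_lipschitz {h : posreal} (R0 : R) (f g : L2 h) : 0 < R0 ->
  norm (minus (trunc R0 f) (trunc R0 g)) <= 2 * norm (minus f g).
Proof.
intros HR; unfold trunc.
pose proof (Rmax_l R0 (norm f)); pose proof (Rmax_l R0 (norm g)); pose proof (Rmax_r R0 (norm g)).
set (a := Rmax R0 (norm f)) in *; set (b := Rmax R0 (norm g)) in *.
assert (E : minus (scal (R0 / a) f) (scal (R0 / b) g) =
  plus (scal (R0 / a) (minus f g)) (scal (R0 / a - R0 / b) g)) by l2ring.
pose proof (L2norm_ge_0 (minus f g)) as Pd; pose proof (L2norm_ge_0 g) as Pg.
assert (Hab : Rabs (b - a) <= norm (minus f g)).
{ assert (T : Rabs (norm g - norm f) <= norm (minus f g)).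
  { apply Rabs_le; split.
    - pose proof (L2norm_le_minus f g); lra.
    - pose proof (L2norm_le_minus g f) as T; rewrite L2norm_minus_sym in T; lra. }
  apply Rle_trans with (2 := T); unfold a, b, Rmax.
  destruct (Rle_dec R0 (norm f)), (Rle_dec R0 (norm g)); unfold Rabs; repeat destruct Rcase_abs; lra. }
assert (Q1 : norm (scal (R0 / a) (minus f g)) <= norm (minus f g)).
{ eapply Rle_trans; [apply L2norm_scal|].
  rewrite Rabs_pos_eq by (apply Rdiv_le_0_compat; lra).
  assert (R0 / a <= 1) by (apply Rle_div_l; lra); nra. }
assert (Q2 : norm (scal (R0 / a - R0 / b) g) <= norm (minus f g)).
{ eapply Rle_trans; [apply L2norm_scal|].
  (* R0 <= a and norm g <= b absorb the denominator, and |b - a| is controlled because the maximum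
     with R0 is 1-Lipschitz. *)
  replace (R0 / a - R0 / b) with (R0 / (a * b) * (b - a)) by (field; lra).
  assert (Hp : 0 < a * b) by (apply Rmult_lt_0_compat; lra).
  rewrite Rabs_mult, (Rabs_pos_eq (R0 / (a * b))) by (apply Rdiv_le_0_compat; lra).
  apply Rle_trans with (R0 / (a * b) * norm (minus f g) * norm g).
  - apply Rmult_le_compat_r; [lra|apply Rmult_le_compat_l; [apply Rdiv_le_0_compat; lra|lra]].
  - apply Rmult_le_reg_r with (a * b); [lra|].
    replace (R0 / (a * b) * norm (minus f g) * norm g * (a * b))
      with (R0 * norm g * norm (minus f g)) by (field; lra).
    rewrite (Rmult_comm (norm (minus f g)) (a * b)); apply Rmult_le_compat_r; [lra|].
    apply Rmult_le_compat; lra. }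
eapply Rle_trans; [right; apply (f_equal norm E)|].
eapply Rle_trans; [apply L2norm_triangle|].
replace (2 * norm (minus f g)) with (norm (minus f g) + norm (minus f g)) by ring.
apply Rplus_le_compat; [exact Q1|exact Q2].
Qed.

(* i times dav Lap f + <Q_h>(f). *)
Definition dm_field {h : posreal} {p : R} (hp : 1 < p) (dav : R) (f : L2 h) : L2 h :=
  plus (L2_cscal Ci (Qav hp f)) (scal dav (iLap f)).

Definition dm_lip (h : posreal) (p dav R0 : R) : R := nl_lip h p R0 + Rabs dav * (4 / h ^ 2).

Lemma dm_lip_ge_0 (h : posreal) (p dav R0 : R) : 1 < p -> 0 <= dm_lip h p dav R0.
Proof.
intros Hp; pose proof (nl_lip_ge_0 h p R0 Hp); pose proof (cond_pos h).
apply Rplus_le_le_0_compat; auto; apply Rmult_le_pos; [apply Rabs_pos|].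
apply Rdiv_le_0_compat; [lra|apply pow_lt; lra].
Qed.

Lemma dm_field_lipschitz {h : posreal} {p : R} (hp : 1 < p) (dav R0 : R) (f g : L2 h) :
  norm f <= R0 -> norm g <= R0 ->
  norm (minus (dm_field hp dav f) (dm_field hp dav g)) <= dm_lip h p dav R0 * norm (minus f g).
Proof.
intros Hf Hg; unfold dm_lip.
assert (E : minus (dm_field hp dav f) (dm_field hp dav g) =
  plus (L2_cscal Ci (minus (Qav hp f) (Qav hp g))) (scal dav (iLap (minus f g))))
  by (unfold dm_field; rewrite iLap_minus; l2ring).
eapply Rle_trans; [right; apply (f_equal norm E)|].
eapply Rle_trans; [apply L2norm_triangle|]; rewrite Rmult_plus_distr_r.
apply Rplus_le_compat.
- eapply Rle_trans; [apply norm_cscal_le|]; rewrite Cmod_Ci, Rmult_1_l.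
  now apply Qav_lipschitz.
- eapply Rle_trans; [apply L2norm_scal|]; rewrite Rmult_assoc.
  apply Rmult_le_compat_l; [apply Rabs_pos|apply norm_iLap_le].
Qed.

Lemma ip_dm_field {h : posreal} {p : R} (hp : 1 < p) (dav : R) (f : L2 h) :
  ip f (dm_field hp dav f) = 0.
Proof.
unfold dm_field; rewrite ip_plus_r, ip_scal_r, ip_iLap_diag.
pose proof (ip_Ci_l f (Qav hp f)) as E.
rewrite ip_sym, ip_Qav_Ci in E; lra.
Qed.

(** * Existence and stability for the ODE *)

Definition ode_solution {h : posreal} {p : R} (hp : 1 < p) (dav : R) (phi : L2 h)
    (u : R -> L2 h) : Prop :=
  u 0 = phi /\ forall t, is_derive u t (dm_field hp dav (u t)).

Lemma ode_norm {h : posreal} {p : R} (hp : 1 < p) (dav : R) (phi : L2 h) (u : R -> L2 h) :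
  ode_solution hp dav phi u -> forall t, norm (u t) = norm phi.
Proof.
intros [H0 Hu] t; rewrite <- H0.
apply (norm_constant u (fun t => dm_field hp dav (u t))); auto.
intros s; apply ip_dm_field.
Qed.

Lemma ode_exists {h : posreal} {p : R} (hp : 1 < p) (dav : R) (phi : L2 h) :
  exists u, ode_solution hp dav phi u.
Proof.
(* The summand 1 keeps the radius positive when phi = 0. *)
set (R0 := norm phi + 1).
pose proof (L2norm_ge_0 phi); assert (HR : 0 < R0) by (unfold R0; lra).
pose proof (dm_lip_ge_0 h p dav R0 hp) as HL.
(* The factor 2 is the Lipschitz constant of [trunc]; the summand 1 makes the whole constant
   positive, as the Picard iteration requires. *)
assert (Lip : forall f g : L2 h,
  norm (minus (dm_field hp dav (trunc R0 f)) (dm_field hp dav (trunc R0 g)))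
  <= (2 * dm_lip h p dav R0 + 1) * norm (minus f g)).
{ intros f g; pose proof (trunc_lipschitz R0 f g HR) as T.
  apply Rmult_le_compat_l with (r := dm_lip h p dav R0) in T; auto.
  eapply Rle_trans; [apply (dm_field_lipschitz hp dav R0); now apply norm_trunc_le|].
  apply Rle_trans with (1 := T); pose proof (L2norm_ge_0 (minus f g)); lra. }
assert (Pic : exists u : R -> L2 h, u 0 = phi /\
  forall t, is_derive u t (dm_field hp dav (trunc R0 (u t)))).
{ apply (picard_lindelof (V := L2_CompleteNormedModule h)
    (fun f => dm_field hp dav (trunc R0 f)) (2 * dm_lip h p dav R0 + 1)); [lra|exact Lip]. }
destruct Pic as [u [H0 Hu]].
exists u; split; auto; intros t.
assert (N : forall t, norm (u t) = norm (u 0)).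
{ apply (norm_constant u (fun t => dm_field hp dav (trunc R0 (u t)))); auto.
  intros s; pose proof (ip_dm_field hp dav (trunc R0 (u s))) as E.
  unfold trunc at 1 in E; rewrite ip_scal_l in E.
  apply Rmult_integral in E; destruct E as [E|E]; auto; exfalso.
  assert (0 < R0 / Rmax R0 (norm (u s))); [|lra].
  apply Rdiv_lt_0_compat; auto; pose proof (Rmax_l R0 (norm (u s))); lra. }
replace (dm_field hp dav (u t)) with (dm_field hp dav (trunc R0 (u t))); [apply Hu|].
f_equal; apply trunc_id; auto.
rewrite N, H0; unfold R0; lra.
Qed.

(** Norm conservation keeps both solutions in the ball, where one Lipschitz constant K holds.
    Gronwall acts on the squared distance, which is differentiable also where it vanishes; its rate
    2K becomes K after the square root. *)
Lemma ode_stability {h : posreal} {p : R} (hp : 1 < p) (dav R0 : R) (phi psi : L2 h)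
    (u v : R -> L2 h) :
  ode_solution hp dav phi u -> ode_solution hp dav psi v -> norm phi <= R0 -> norm psi <= R0 ->
  forall t, norm (minus (v t) (u t)) <= norm (minus psi phi) * exp (dm_lip h p dav R0 * Rabs t).
Proof.
intros Hu Hv Nu Nv t.
pose proof (ode_norm hp dav phi u Hu) as Bu; pose proof (ode_norm hp dav psi v Hv) as Bv.
destruct Hu as [<- Hu], Hv as [<- Hv].
set (K := dm_lip h p dav R0).
assert (G : norm (minus (v t) (u t)) ^ 2 <= norm (minus (v 0) (u 0)) ^ 2 * exp (2 * K * Rabs t)).
{ apply (gronwall (fun t => norm (minus (v t) (u t)) ^ 2)
    (fun t => 2 * ip (minus (v t) (u t)) (minus (dm_field hp dav (v t)) (dm_field hp dav (u t))))).
  - intros s; apply (is_derive_norm_sq (fun t => minus (v t) (u t))).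
    apply (is_derive_minus (V := L2_NormedModule h)); auto.
  - intros s; rewrite Rabs_mult, (Rabs_pos_eq 2), Rmult_assoc by lra.
    apply Rmult_le_compat_l; [lra|].
    eapply Rle_trans; [apply Rabs_ip_le|].
    replace (K * norm (minus (v s) (u s)) ^ 2)
      with (norm (minus (v s) (u s)) * (K * norm (minus (v s) (u s)))) by ring.
    apply Rmult_le_compat_l; [apply L2norm_ge_0|].
    apply dm_field_lipschitz; [rewrite Bv|rewrite Bu]; auto. }
replace (2 * K * Rabs t) with (K * Rabs t + K * Rabs t) in G by ring.
rewrite exp_plus in G.
pose proof (exp_pos (K * Rabs t)).
pose proof (L2norm_ge_0 (minus (v t) (u t))); pose proof (L2norm_ge_0 (minus (v 0) (u 0))).
apply Rsqr_incr_0; [unfold Rsqr; lra|auto|apply Rmult_le_pos; lra].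
Qed.

(** * Equivalence of Duhamel's formula and the ODE *)

Lemma continuous_Qav_comp {h : posreal} {p : R} (hp : 1 < p) (u : R -> L2 h) (t : R) :
  continuous u t -> continuous (fun s => Qav hp (u s)) t.
Proof.
intros Hu; apply L2_continuous_eps; intros e He.
set (L := nl_lip h p (norm (u t) + 1)).
assert (HL : 0 <= L) by now apply nl_lip_ge_0.
destruct (proj1 (L2_continuous_eps u t) Hu (Rmin 1 (e / (L + 1)))) as [d [Hd H]].
{ apply Rmin_pos; [lra|apply Rdiv_lt_0_compat; lra]. }
exists d; split; auto; intros y Hy; specialize (H y Hy).
pose proof (Rmin_l 1 (e / (L + 1))); pose proof (Rmin_r 1 (e / (L + 1))).
pose proof (L2norm_ge_0 (minus (u y) (u t))) as P.
eapply Rle_lt_trans; [apply (Qav_lipschitz hp (norm (u t) + 1))|].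
- pose proof (L2norm_le_minus (u y) (u t)); lra.
- lra.
- fold L; apply Rle_lt_trans with ((L + 1) * norm (minus (u y) (u t))).
  + apply Rmult_le_compat_r; lra.
  + replace e with ((L + 1) * (e / (L + 1))) by (field; lra).
    apply Rmult_lt_compat_l; lra.
Qed.

Lemma continuous_duhamel {h : posreal} {p : R} (hp : 1 < p) (dav : R) (u : R -> L2 h) :
  (forall t, continuous u t) ->
  forall t, continuous (fun s => L2_cscal Ci (Th (- dav * s) (Qav hp (u s)))) t.
Proof.
intros Hu t.
apply (continuous_comp (fun s => Th (- dav * s) (Qav hp (u s))) (L2_cscal Ci)).
- now apply (continuous_Th (- dav) (fun s => Qav hp (u s))), continuous_Qav_comp.
- apply (linear_cont (U := L2_NormedModule h) (V := L2_NormedModule h)), is_linear_cscal.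
Qed.

(** The group law pulls the t-dependence out of the integral, and the remaining integrand is free of
    t, so the fundamental theorem of calculus applies to it. *)
Lemma duhamel_factor {h : posreal} {p : R} (hp : 1 < p) (dav : R) (phi : L2 h) (u : R -> L2 h) :
  (forall t, continuous u t) -> forall t,
  plus (Th (dav * t) phi) (L2_cscal Ci (RInt (fun s => Th (dav * (t - s)) (Qav hp (u s))) 0 t)) =
  Th (dav * t) (plus phi (RInt (fun s => L2_cscal Ci (Th (- dav * s) (Qav hp (u s)))) 0 t)).
Proof.
intros Hu t; rewrite Th_plus; f_equal.
assert (Hc : forall s, continuous (fun s => Th (dav * (t - s)) (Qav hp (u s))) s).
{ intros s; apply (continuous_ext (fun s => Th (dav * t) (Th (- dav * s) (Qav hp (u s))))).
  - intros x; rewrite <- Th_add; f_equal; ring.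
  - apply (continuous_comp (fun s => Th (- dav * s) (Qav hp (u s))) (Th (dav * t))).
    + now apply (continuous_Th (- dav) (fun s => Qav hp (u s))), continuous_Qav_comp.
    + apply (linear_cont (U := L2_NormedModule h) (V := L2_NormedModule h)), is_linear_Th. }
rewrite <- (RInt_linear (V := L2_CompleteNormedModule h) (W := L2_CompleteNormedModule h)
  (L2_cscal Ci)) by (apply is_linear_cscal || exact Hc).
rewrite <- (RInt_linear (V := L2_CompleteNormedModule h) (W := L2_CompleteNormedModule h)
  (Th (dav * t))) by (apply is_linear_Th || now apply continuous_duhamel).
apply RInt_ext; intros s _; rewrite Th_cscal, <- Th_add; do 2 f_equal; ring.
Qed.

Lemma is_solution_ode {h : posreal} {p : R} (hp : 1 < p) (dav : R) (phi : L2 h) (u : R -> L2 h) :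
  is_solution hp dav phi u <-> ode_solution hp dav phi u.
Proof.
set (w := fun s => L2_cscal Ci (Th (- dav * s) (Qav hp (u s)))).
set (v := fun t => plus phi (RInt w 0 t)).
assert (Rot : forall t, Th (dav * t) (w t) = L2_cscal Ci (Qav hp (u t))).
{ intros t; unfold w; rewrite Th_cscal, <- Th_add.
  replace (dav * t + - dav * t) with 0 by ring; now rewrite Th_0. }
split.
- intros [Hc Hu].
  assert (Hw : forall t, continuous w t) by now apply continuous_duhamel.
  assert (E : forall t, u t = Th (dav * t) (v t)).
  { intros t; rewrite Hu; now apply duhamel_factor. }
  split.
  + rewrite E, Rmult_0_r, Th_0; unfold v; rewrite RInt_point.
    apply (plus_zero_r (G := L2_AbelianMonoid h)).
  + intros t; apply (is_derive_ext (fun t => Th (dav * t) (v t))); [intros s; symmetry; apply E|].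
    unfold dm_field; rewrite <- Rot, E.
    apply is_derive_Th_comp.
    replace (w t) with (plus zero (w t)) by l2ring.
    apply (is_derive_plus (V := L2_NormedModule h));
      [apply (is_derive_const (V := L2_NormedModule h) phi t)|].
    now apply (is_derive_RInt_cont (V := L2_CompleteNormedModule h)).
- intros [H0 Hu].
  assert (Hc : forall t, continuous u t).
  { intros t; eapply (is_derive_continuous (V := L2_NormedModule h)), Hu. }
  assert (Hw : forall t, continuous w t) by now apply continuous_duhamel.
  split; auto; intros t; rewrite (duhamel_factor hp dav phi u Hc); fold w.
  (* The linear part of the field cancels against the derivative of the group, with which [iLap]
     commutes; only the nonlinear part is left. *)
  assert (D : forall t, is_derive (fun t => Th (- dav * t) (u t)) t (w t)).
  { intros s; pose proof (is_derive_Th_comp (- dav) u s _ (Hu s)) as D.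
    replace (w s) with (plus (Th (- dav * s) (dm_field hp dav (u s)))
      (scal (- dav) (iLap (Th (- dav * s) (u s))))); [exact D|].
    unfold dm_field, w; rewrite Th_plus, Th_scal, Th_cscal, Th_iLap; l2ring. }
  assert (I : RInt w 0 t = minus (Th (- dav * t) (u t)) (Th (- dav * 0) (u 0))).
  { apply (is_RInt_unique (V := L2_CompleteNormedModule h)).
    apply (is_RInt_derive (V := L2_CompleteNormedModule h) (fun t => Th (- dav * t) (u t))); auto. }
  rewrite I, Rmult_0_r, Th_0, H0.
  replace (plus phi (minus (Th (- dav * t) (u t)) phi)) with (Th (- dav * t) (u t)) by l2ring.
  rewrite <- Th_add; replace (dav * t + - dav * t) with 0 by ring; now rewrite Th_0.
Qed.

(** * Conservation of the energy *)

Lemma energy_eq {h : posreal} (p dav : R) (f : L2 h) :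
  energy p dav f = - (dav / 2) * ip (Lap f) f - 1 / (p + 1) * potential p f.
Proof. unfold energy; rewrite norm_Dplus_sq; unfold potential, Lq_pow; ring. Qed.

Lemma energy_taylor {h : posreal} {p : R} (hp : 1 < p) (dav R0 : R) (z w : L2 h) :
  norm z <= R0 -> norm w <= R0 ->
  Rabs (energy p dav w - energy p dav z
    - ip (opp (plus (Qav hp z) (scal dav (Lap z)))) (minus w z))
  <= (Rabs dav * (4 / h ^ 2) + taylor_cst h p R0) * norm (minus w z) ^ 2.
Proof.
intros Hz Hw; rewrite !energy_eq, ip_opp_l, ip_plus_l, ip_scal_l.
pose proof (potential_taylor hp R0 z w Hz Hw) as T.
set (d := minus w z) in *.
(* By symmetry of Lap the kinetic part is an exact quadratic form, so its remainder is the form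
   evaluated at d. *)
assert (E : ip (Lap w) w - ip (Lap z) z - 2 * ip (Lap z) d = ip (Lap d) d).
{ replace w with (plus z d) by (unfold d; l2ring).
  rewrite Lap_plus, !ip_plus_l, !ip_plus_r, (Lap_sym d z), (ip_sym d (Lap z)); ring. }
set (H := potential p w - potential p z - (p + 1) * ip (Qav hp z) d) in *.
replace (_ - _ - _) with (- (dav / 2) * ip (Lap d) d + - / (p + 1) * H)
  by (rewrite <- E; unfold H; field; lra).
eapply Rle_trans; [apply Rabs_triang|]; rewrite Rmult_plus_distr_r.
pose proof (L2norm_ge_0 d) as Pd; pose proof (cond_pos h) as Hh.
assert (HM : 0 < 4 / h ^ 2) by (apply Rdiv_lt_0_compat; [lra|apply pow_lt; lra]).
apply Rplus_le_compat.
- rewrite Rabs_mult, Rabs_Ropp, Rmult_assoc.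
  apply Rmult_le_compat; try apply Rabs_pos.
  + unfold Rdiv; rewrite Rabs_mult, (Rabs_pos_eq (/ 2)) by lra; pose proof (Rabs_pos dav); lra.
  + eapply Rle_trans; [apply Rabs_ip_le|].
    replace (4 / h ^ 2 * norm d ^ 2) with (4 / h ^ 2 * norm d * norm d) by ring.
    apply Rmult_le_compat_r; [auto|apply norm_Lap_le].
- rewrite Rabs_mult, Rabs_Ropp, Rabs_pos_eq by (left; apply Rinv_0_lt_compat; lra).
  assert (/ (p + 1) <= 1) by (rewrite <- Rinv_1; apply Rinv_le_contravar; lra).
  pose proof (Rabs_pos H).
  apply Rle_trans with (1 * Rabs H); [apply Rmult_le_compat_r; lra|lra].
Qed.

Lemma ode_energy {h : posreal} {p : R} (hp : 1 < p) (dav : R) (phi : L2 h) (u : R -> L2 h) :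
  ode_solution hp dav phi u -> forall t, energy p dav (u t) = energy p dav phi.
Proof.
intros [<- Hu]; apply (constant_of_derive_0 (fun t => energy p dav (u t))); intros t.
set (X := plus (Qav hp (u t)) (scal dav (Lap (u t)))).
replace 0 with (ip (opp X) (dm_field hp dav (u t))).
- apply (is_derive_chain (energy p dav) u t
    (Rabs dav * (4 / h ^ 2) + taylor_cst h p (norm (u t) + 1))); auto.
  intros w Hw; apply energy_taylor; [lra|].
  pose proof (L2norm_le_minus w (u t)); lra.
- replace (dm_field hp dav (u t)) with (L2_cscal Ci X) by (unfold X, dm_field, iLap; l2ring).
  rewrite ip_opp_l, ip_Ci_diag; ring.
Qed.

Theorem theorem1p1 (dav : R) (h : posreal) (h_le1 : h <= 1) (p : R) (hp : 1 < p) :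
  (forall phi : L2 h, exists! u : R -> L2 h, is_solution hp dav phi u) /\
  (forall (phi : L2 h) (u : R -> L2 h), is_solution hp dav phi u ->
     forall T0 : R, 0 < T0 -> forall eps : R, 0 < eps ->
     exists delta : R, 0 < delta /\
       forall (psi : L2 h) (v : R -> L2 h), is_solution hp dav psi v ->
         norm (minus psi phi) < delta ->
         forall t : R, - T0 <= t <= T0 -> norm (minus (v t) (u t)) < eps) /\
  (forall (phi : L2 h) (u : R -> L2 h), is_solution hp dav phi u ->
     forall t : R,
       norm (u t) ^ 2 = norm phi ^ 2 /\ energy p dav (u t) = energy p dav phi).
Proof.
split; [|split].
- intros phi; destruct (ode_exists hp dav phi) as [u Hu]; exists u; split.
  + now apply is_solution_ode.
  + intros v Hv; apply is_solution_ode in Hv; apply functional_extensionality; intros t.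
    symmetry; apply (ndist_eq_0 (V := L2_NormedModule h)), Rle_antisym; [|apply ndist_ge_0].
    (* Uniqueness is stability with equal initial data: the bound is 0 times an exponential. *)
    eapply Rle_trans;
      [apply (ode_stability hp dav (norm phi) phi phi u v Hu Hv (Rle_refl _) (Rle_refl _) t)|].
    replace (norm (minus phi phi)) with 0; [lra|].
    symmetry; apply (ndist_refl (V := L2_NormedModule h)).
- intros phi u Hu T0 HT eps He; apply is_solution_ode in Hu.
  (* With delta at most 1 every admissible psi lies in the ball of radius norm phi + 1, so that K
     does not depend on psi. *)
  set (K := dm_lip h p dav (norm phi + 1)).
  pose proof (exp_pos (K * T0)) as HE.
  exists (Rmin 1 (eps / exp (K * T0))); split.
  { apply Rmin_pos; [lra|apply Rdiv_lt_0_compat; lra]. }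
  intros psi v Hv Hd t Ht; apply is_solution_ode in Hv.
  pose proof (Rmin_l 1 (eps / exp (K * T0))); pose proof (Rmin_r 1 (eps / exp (K * T0))).
  eapply Rle_lt_trans; [apply (ode_stability hp dav (norm phi + 1) phi psi u v Hu Hv)|].
  + lra.
  + pose proof (L2norm_le_minus psi phi); lra.
  + fold K; pose proof (L2norm_ge_0 (minus psi phi)).
    assert (exp (K * Rabs t) <= exp (K * T0)).
    { apply Rnot_lt_le; intros X; apply exp_lt_inv in X; revert X.
      apply Rle_not_lt, Rmult_le_compat_l; [now apply dm_lip_ge_0|now apply Rabs_le]. }
    apply Rle_lt_trans with (norm (minus psi phi) * exp (K * T0)).
    * apply Rmult_le_compat_l; lra.
    * replace eps with (eps / exp (K * T0) * exp (K * T0)) by (field; lra).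
      apply Rmult_lt_compat_r; lra.
- intros phi u Hu t; apply is_solution_ode in Hu; split.
  + now rewrite (ode_norm hp dav phi u Hu).
  + now apply ode_energy with hp.
Qed.
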